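(* Let $(E,(\cdot,\cdot),\mathcal H)$ be an extended affine Lie algebra of reduced type and of rank $>1$, with root system $R$ and core $E_c$. Let $\tau$ be a Chevalley involution for $E_c$ and let $\mathcal C=\{x_\alpha\mid\alpha\in R^\times\}$ be a Chevalley system for $(E_c,\tau)$. Then $\mathcal C$ extends to an integral structure $\mathcal B\supseteq\mathcal C$ for $(E_c,\tau)$. Moreover, $\mathcal B$ can be chosen such that for every $\sigma\in R^0$ the rank of the free abelian group $\mathrm{span}_{\mathbb Z}(\mathcal B\cap E_\sigma)$ is less than or equal to $\mathrm{refl}(R)$.
   Context: All vector spaces are over $\mathbb C$. An extended affine Lie algebra is a triple $(E,(\cdot,\cdot),\mathcal H)$ such that: (A1) $E$ is a Lie algebra with a symmetric invariant non-degenerate bilinear form $(\cdot,\cdot)$; (A2) $\mathcal H$ is a non-trivial finite-dimensional subalgebra with $E=\sum_{\alpha\in\mathcal H^\star}E_\alpha$, $E_\alpha=\{x\in E\mid [h,x]=\alpha(h)x\ \forall h\in\mathcal H\}$, and $E_0=\mathcal H$; (A3) $\mathrm{ad}\,x$ is locally nilpotent for each $x\in E_\alpha$, $\alpha\in R^\times$; (A4) (tameness) the centralizer of $E_c$ in $E$ is contained in $E_c$; (A5) the $\mathbb Z$-span of $R$ in $\mathcal H^\star$ is a free abelian group of finite rank; (A6) if $R^\times=R_1\uplus R_2$ with $R_1,R_2\neq\emptyset$, then $R_1\not\perp R_2$. Here $R=\{\alpha\in\mathcal H^\star\mid E_\alpha\ne\{0\}\}$ is the root system; for $\alpha\in R$,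 $t_\alpha\in\mathcal H$ is the unique element with $\alpha(h)=(h,t_\alpha)$ for all $h\in\mathcal H$; $(\alpha,\beta):=(t_\alpha,t_\beta)$; $R^0=\{\alpha\in R\mid(\alpha,\alpha)=0\}$ (isotropic roots), $R^\times=R\setminus R^0$ (non-isotropic roots); the core $E_c$ is the subalgebra of $E$ generated by the root spaces $E_\alpha$, $\alpha\in R^\times$. For $\alpha\in R^\times$, $h_\alpha:=2t_\alpha/(\alpha,\alpha)$. With $\mathcal V=\mathrm{span}_{\mathbb R}R$ and $\mathcal V^0=\mathrm{span}_{\mathbb R}R^0$, the image of $R$ in $\mathcal V/\mathcal V^0$ is an irreducible finite root system; its type and rank are the type and rank of $E$. Reduced type means that this finite root system is reduced (type $BC$ excluded). Reflectable bases: write $\mathcal V=\dot{\mathcal V}\oplus\mathcal V^0$, where $\dot{\mathcal V}$ is the real span of a suitable finite root system $\dot R\subset\mathcal V$ mapping isomorphically onto the image of $R$ in $\mathcal V/\mathcal V^0$. Put $\tilde{\mathcal V}=\mathcal V\oplus(\mathcal V^0)^\star$ and extend the form by $(\gamma,\sigma)=\gamma(\sigma)$ for $\gamma\in(\mathcal V^0)^\star,\sigma\in\mathcal V^0$, and $(\dot{\mathcal V},(\mathcal V^0)^\star)=((\mathcal V^0)^\star,(\mathcal V^0)^\star)=\{0\}$. For $\alpha\in R^\times$, $w_\alpha\in GL(\tilde{\mathcal V})$ is the reflection sending $\alpha$ to $-\alpha$ and fixing pointwise the hyperplane orthogonal to $\alpha$. For $\Pi\subseteq R^\times$, $\mathcal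 W_\Pi$ is the group generated by the $w_\alpha$, $\alpha\in\Pi$. A reflectable base of $R$ is a subset $\Pi\subseteq R^\times$ with $\mathcal W_\Pi\Pi=R^\times$ such that no proper subset of $\Pi$ has this property; $\mathrm{refl}(R)$ is the minimum cardinality of a reflectable base. A Chevalley involution for $E_c$ is a finite order automorphism $\tau$ of $E_c$ with $\tau(E_\alpha)=E_{-\alpha}$ for all $\alpha\in R^\times$. A Chevalley system for $(E_c,\tau)$ is a set $\{x_\alpha\in E_\alpha\mid\alpha\in R^\times\}$ such that $[x_\alpha,x_{-\alpha}]=h_\alpha$ and $\tau(x_\alpha)=-x_{-\alpha}$ for all $\alpha\in R^\times$. An integral structure for $(E_c,\tau)$ is a subset $\mathcal B\subseteq E_c$ such that: (C1) elements of $\mathcal B$ are root vectors of $E$ (non-zero elements of root spaces); (C2) $\tau(\mathcal B)=-\mathcal B$; (C3) $\{\mathcal B\cap E_\alpha\mid\alpha\in R^\times\}$ is a Chevalley system for $(E_c,\tau)$ (so each $\mathcal B\cap E_\alpha$, $\alpha\in R^\times$, is a singleton); (C4) for $\sigma\in R^0$, $\mathrm{span}_{\mathbb Z}(\mathcal B\cap E_\sigma)=\sum_{\alpha\in R^\times}\mathbb Z[\mathcal B\cap E_{\alpha+\sigma},\mathcal B\cap E_{-\alpha}]$. *)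

(* Defs.v *)
From HB Require Import structures.
From mathcomp Require Import all_boot all_order all_algebra.
From mathcomp Require Import sesquilinear complex.
From mathcomp Require Import boolp classical_sets functions cardinality reals.

Set Implicit Arguments.
Unset Strict Implicit.
Unset Printing Implicit Defensive.

Import Order.TTheory GRing.Theory Num.Theory.
Local Open Scope classical_set_scope.
Local Open Scope card_scope.
Local Open Scope ring_scope.
Local Open Scope complex_scope.

Definition zspan (M : zmodType) (A : set M) : set M :=
  [set v | exists n (c : 'I_n -> int) (a : 'I_n -> M),
    (forall i, A (a i)) /\ v = \sum_(i < n) a i *~ c i].

Definition free_abelian_of_rank (M : zmodType) (S : set M) (r : nat) : Prop :=
  exists b : 'I_r -> M, zspan (range b) = S /\
    forall c : 'I_r -> int, \sum_(i < r) b i *~ c i = 0 -> forall i, c i = 0.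

Definition lspan (K : pzRingType) (V : lmodType K) (A : set V) : set V :=
  [set v | exists n (c : 'I_n -> K) (a : 'I_n -> V),
    (forall i, A (a i)) /\ v = \sum_(i < n) c i *: a i].

Section SpanType.
Context {K : pzRingType} {V : lmodType K}.
Implicit Type A : set V.

Definition in_span A : {pred V} := fun v => `[< lspan A v >].

Lemma in_span_submod A : submod_closed (in_span A).
Proof.
split; first by apply/asboolP; exists 0%N, (fun=> 0), (fun=> 0); split=> [[]//|];
  rewrite big_ord0.
move=> k _ _ /asboolP[n [c [a [Aa ->]]]] /asboolP[m [d [b [Ab ->]]]].
apply/asboolP.
exists (n + m)%N,
  (fun i : 'I_(n + m) => match fintype.split i with inl j => k * c j | inr j => d j end),
  (fun i : 'I_(n + m) => match fintype.split i with inl j => a j | inr j => b j end).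
split; first by move=> i; case: (fintype.split i).
rewrite big_split_ord/= scaler_sumr; congr (_ + _); apply: eq_bigr => i _.
- by rewrite (unsplitK (inl i)) scalerA.
- by rewrite (unsplitK (inr i)).
Qed.

HB.instance Definition _ A := GRing.isSubmodClosed.Build K V (in_span A)
  (in_span_submod A).

Record span_type A := SpanType {
  span_val : V;
  span_valP : span_val \in in_span A }.

HB.instance Definition _ A := [isSub for @span_val A].
HB.instance Definition _ A := [Choice of span_type A by <:].
HB.instance Definition _ A := [SubChoice_isSubLmodule of span_type A by <:].

End SpanType.

(* Restriction of scalars from R[i] to R, used to form real spans of roots. *)
Definition realified (R : realType) (V : lmodType R[i]) : Type := V.

Section Realified.
Context (R : realType) (V : lmodType R[i]).
HB.instance Definition _ := GRing.Zmodule.on (realified V).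

Definition rscale (a : R) (v : realified V) : realified V :=
  (a%:C *: (v : V) : V).

Lemma rscaleA a b v : rscale a (rscale b v) = rscale (a * b) v.
Proof. by rewrite /rscale scalerA -rmorphM. Qed.
Lemma rscale1 : left_id 1 rscale.
Proof. by move=> v; rewrite /rscale rmorph1 scale1r. Qed.
Lemma rscaleDr : right_distributive rscale +%R.
Proof. by move=> a u v; rewrite /rscale scalerDr. Qed.
Lemma rscaleDl v : {morph rscale^~ v : a b / a + b}.
Proof. by move=> a b; rewrite /rscale rmorphD/= scalerDl. Qed.
HB.instance Definition _ := GRing.Zmodule_isLmodule.Build R (realified V)
  rscaleA rscale1 rscaleDr rscaleDl.
End Realified.

HB.mixin Record Lmodule_isLie (K : fieldType) E of GRing.Lmodule K E := {
  lie : E -> E -> E;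
  lie_bilinear : bilinear_for *:%R *:%R lie;
  lie_xx : forall x, lie x x = 0;
  lie_jacobi : forall x y z,
    lie x (lie y z) + lie y (lie z x) + lie z (lie x y) = 0 }.

#[short(type="lieAlgType")]
HB.structure Definition LieAlgebra (K : fieldType) :=
  { E of GRing.Lmodule K E & Lmodule_isLie K E }.

Definition lie_subalgebra (K : fieldType) (E : lieAlgType K) (S : set E) : Prop :=
  submod_closed [in S] /\ forall x y, S x -> S y -> S (lie x y).

(* The finite-dimensional subalgebra H of E is given as a finite-dimensional
   space [cartan] together with a linear map [incl] into E, required to be
   injective in [is_eala]; in this way the dual of H is a library type. *)
Record toral_triple (R : realType) := ToralTriple {
  lie_alg :> lieAlgType R[i];
  form : {biscalar lie_alg};
  cartan : vectType R[i];
  incl : {linear cartan -> lie_alg} }.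

Arguments form {R} t.
Arguments incl {R} t.

Section RootSystem.
Context {R : realType} (E : toral_triple R).

Definition dual_cartan := 'Hom(cartan E, R[i]^o).
Implicit Types (alpha beta sigma : dual_cartan).

Definition root_space alpha : set E :=
  [set x | forall h, lie (incl E h) x = (alpha h : R[i]) *: x].

Definition roots : set dual_cartan :=
  [set alpha | exists2 x, root_space alpha x & x != 0].

(* By non-degeneracy t_ alpha is the unique element of this set, so the default
   value 0 is never used for a root. *)
Definition t_ alpha : cartan E :=
  xget 0 [set t | forall h, alpha h = form E (incl E h) (incl E t)].

Definition dual_form alpha beta : R[i] :=
  form E (incl E (t_ alpha)) (incl E (t_ beta)).

Definition isotropic_roots : set dual_cartan :=
  roots `&` [set alpha | dual_form alpha alpha = 0].

Definition nonisotropic_roots : set dual_cartan := roots `\` isotropic_roots.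

Definition core : set E :=
  smallest (@lie_subalgebra _ E)
    (\bigcup_(alpha in nonisotropic_roots) root_space alpha).

Definition h_ alpha : cartan E := (2 / dual_form alpha alpha) *: t_ alpha.

Record is_eala : Prop := IsEALA {
  form_sym : forall x y, form E x y = form E y x;
  form_invariant : forall x y z, form E (lie x y) z = form E x (lie y z);
  form_nondegenerate : forall x, (forall y, form E x y = 0) -> x = 0;
  incl_inj : injective (incl E);
  incl_lie : forall h k, range (incl E) (lie (incl E h) (incl E k));
  cartan_nontrivial : exists h : cartan E, h != 0;
  root_decomposition : forall x : E,
    exists n (alpha : 'I_n -> dual_cartan) (y : 'I_n -> E),
      (forall i, root_space (alpha i) (y i)) /\ x = \sum_(i < n) y i;
  zero_root_space : root_space 0 = range (incl E);
  ad_locally_nilpotent : forall alpha x, nonisotropic_roots alpha ->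
    root_space alpha x -> forall y, exists n, iter n (lie x) y = 0;
  tame : forall x, (forall y, core y -> lie x y = 0) -> core x;
  root_lattice_free : exists n, free_abelian_of_rank (zspan roots) n;
  roots_indecomposable : forall R1 R2 : set dual_cartan,
    R1 `|` R2 = nonisotropic_roots -> R1 `&` R2 = set0 ->
    R1 !=set0 -> R2 !=set0 ->
    exists alpha beta, [/\ R1 alpha, R2 beta & dual_form alpha beta != 0] }.

End RootSystem.

Arguments roots {R} E _.
Arguments isotropic_roots {R} E _.
Arguments nonisotropic_roots {R} E _.
Arguments core {R} E _.

Record eala (R : realType) := EALA {
  eala_triple :> toral_triple R;
  ealaP : is_eala eala_triple }.

Section RealSpan.
Context {R : realType} (E : eala R).

(* V = span_R R and V^0 = span_R R^0 *)
Definition root_span : lmodType R :=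
  span_type (roots E : set (realified (dual_cartan E))).
Definition null_span : lmodType R :=
  span_type (isotropic_roots E : set (realified (dual_cartan E))).

Definition weight (v : root_span) : dual_cartan E := \val v.

(* V^0 as a subspace of V *)
Definition null : set root_span :=
  [set v | exists s : null_span, \val s = \val v].

Definition root_vec : set root_span := [set v | roots E (weight v)].
Definition nonisotropic : set root_span :=
  [set v | nonisotropic_roots E (weight v)].

(* In the image of R in V / V^0, the only multiples of a non-zero element
   which are non-zero elements of the image are plus or minus that element.
   Classes modulo V^0 are handled through representatives. *)
Definition reduced_type : Prop :=
  forall (alpha beta : root_span) (c : R),
    root_vec alpha -> root_vec beta -> ~ null alpha -> ~ null beta ->
    null (beta - c *: alpha) -> c = 1 \/ c = -1.

(* dim (V / V^0) = n : the classes of b_0, ..., b_(n-1) form a basis. *)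
Definition has_rank (n : nat) : Prop :=
  exists b : 'I_n -> root_span, forall v : root_span,
    exists! c : 'rV[R]_n, null (v - \sum_(i < n) c 0 i *: b i).

End RealSpan.

Arguments root_vec {R} E _.
Arguments nonisotropic {R} E _.

Definition finite_root_system (R : realType) (V : lmodType R)
    (f : V -> V -> R) (Phi : set V) : Prop :=
  [/\ finite_set Phi, Phi 0,
      forall v, lspan Phi v -> v != 0 -> 0 < f v v &
      forall alpha beta, Phi alpha -> Phi beta -> alpha != 0 ->
        2 * f beta alpha / f alpha alpha \is a Num.int /\
        Phi (beta - (2 * f beta alpha / f alpha alpha) *: alpha)].

(* The choices entering the construction of V (+) (V^0)^*. Since E is
   complex, the form is real-valued on V only up to a scalar; [real_form] is
   the normalization of the form on V for which the finite root system
   [dot_roots] is Euclidean. *)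
Record splitting (R : realType) (E : eala R) := Splitting {
  real_form : root_span E -> root_span E -> R;
  form_scale : R[i];
  form_scale_neq0 : form_scale != 0;
  real_formE : forall u v,
    (real_form u v)%:C = form_scale * dual_form (weight u) (weight v);
  dot_roots : set (root_span E);
  dot_root_system : finite_root_system real_form dot_roots;
  dot_null_cap : forall v, lspan dot_roots v -> null v -> v = 0;
  dot_null_sum : forall v, exists2 u, lspan dot_roots u & null (v - u);
  dot_image : forall a, dot_roots a -> exists2 b, root_vec E b & null (a - b);
  dot_image_onto : forall b, root_vec E b -> exists2 a, dot_roots a & null (a - b) }.

Section Reflectable.
Context {R : realType} {E : eala R} (S : splitting E).

(* Projection of V onto V^0 along the span of the finite root system. *)
Definition null_proj (v : root_span E) : null_span E :=
  xget 0 [set s | exists2 u, lspan (dot_roots S) u & \val v = \val u + \val s].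

(* The elements (v, gamma) of V (+) (V^0)^*. *)
Definition hyp_span : Type := (root_span E * {linear null_span E -> R^o})%type.

Definition hyp_form (u v : hyp_span) : R :=
  real_form S u.1 v.1 + u.2 (null_proj v.1) + v.2 (null_proj u.1).

Definition in_hyp (v : root_span E) : hyp_span :=
  (v, \0 : {linear null_span E -> R^o}).

(* u - 2 (u, alpha) / (alpha, alpha) alpha, for alpha in V *)
Definition reflection (alpha : root_span E) (u : hyp_span) : hyp_span :=
  (u.1 - (2 * hyp_form u (in_hyp alpha)
            / hyp_form (in_hyp alpha) (in_hyp alpha)) *: alpha, u.2).

Definition transformation_group (T : Type) (G : set (T -> T)) : Prop :=
  [/\ G id, forall f g, G f -> G g -> G (f \o g) &
      forall f g, G f -> cancel f g -> cancel g f -> G g].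

Definition weyl_group (Pi : set (root_span E)) : set (hyp_span -> hyp_span) :=
  smallest (@transformation_group hyp_span) (reflection @` Pi).

Definition reflectable_set (Pi : set (root_span E)) : Prop :=
  [set w (in_hyp alpha) | w in weyl_group Pi & alpha in Pi] =
  in_hyp @` nonisotropic E.

Definition reflectable_base (Pi : set (root_span E)) : Prop :=
  [/\ Pi `<=` nonisotropic E, reflectable_set Pi &
      forall Pi', Pi' `<` Pi -> ~ reflectable_set Pi'].

(* The minimum cardinality of a reflectable base. *)
Definition refl : nat :=
  xget 0%N [set m | (exists2 Pi, reflectable_base Pi & Pi #= `I_m) /\
                    forall Pi, reflectable_base Pi -> `I_m #<= Pi].

End Reflectable.

Section Integral.
Context {R : realType} (E : eala R).
Implicit Types (tau : E -> E) (x : dual_cartan E -> E) (B : set E).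

(* Only the restriction of tau to the core is relevant. *)
Definition core_automorphism tau : Prop :=
  [/\ set_bij (core E) (core E) tau,
      forall (a : R[i]) u v, core E u -> core E v ->
        tau (a *: u + v) = a *: tau u + tau v &
      forall u v, core E u -> core E v -> tau (lie u v) = lie (tau u) (tau v)].

Definition chevalley_involution tau : Prop :=
  [/\ core_automorphism tau,
      exists2 n, (0 < n)%N & forall u, core E u -> iter n tau u = u &
      forall alpha, nonisotropic_roots E alpha ->
        tau @` root_space alpha = root_space (- alpha)].

(* The Chevalley system is { x alpha | alpha in R^x }; the values of x
   elsewhere are irrelevant. *)
Definition chevalley_system tau x : Prop :=
  forall alpha, nonisotropic_roots E alpha ->
    [/\ root_space alpha (x alpha),
        lie (x alpha) (x (- alpha)) = incl E (h_ alpha) &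
        tau (x alpha) = - x (- alpha)].

Definition integral_structure tau B : Prop :=
  [/\ B `<=` core E,
      forall b, B b -> b != 0 /\ exists alpha, root_space alpha b,
      tau @` B = -%R @` B,
      exists2 x, chevalley_system tau x &
        forall alpha, nonisotropic_roots E alpha ->
          B `&` root_space alpha = [set x alpha] &
      forall sigma, isotropic_roots E sigma ->
        zspan (B `&` root_space sigma) =
        zspan (\bigcup_(alpha in nonisotropic_roots E)
                 [set lie u v | u in B `&` root_space (alpha + sigma)
                              & v in B `&` root_space (- alpha)])].

End Integral.

(* Main.v *)
(* For isotropic sigma let L_sigma be the Z-span of the brackets
   b(alpha) = [x_(alpha+sigma), x_(-alpha)], alpha in R^x (with x = 0 outside R^x).
   The integral structure is C together with all non-zero elements of all the
   L_sigma; only the rank bound needs work.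

   For beta in R^x put theta = exp(ad x_beta) exp(- ad x_(-beta)) exp(ad x_beta).
   It commutes with tau on the core, hence maps x_alpha to +- x_(w alpha), w = w_beta,
   with the same sign for alpha and - alpha; so theta b(alpha) = +- b(w alpha). On
   the other hand, if [x_beta, z] = m x_(beta+sigma) for z in E_sigma, then
   theta z = z + m b(beta), because 2 beta + sigma is not a root. Hence, once m is
   known to be an integer for z = b(alpha), b(w alpha) lies in Z b(alpha) + Z b(beta),
   and L_sigma is spanned by the b(alpha), alpha in Pi, for any Pi from which the
   reflections in Pi reach all of R^x; the rank is then at most the size of Pi.

   Integrality of m follows from the Jacobi identity and Chevalley's theorem on
   structure constants when neither beta - alpha nor beta + alpha + sigma is
   isotropic. Otherwise beta is +- alpha modulo isotropic roots, and rank > 1 with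
   irreducibility gives gamma, not orthogonal to alpha and independent of it,
   such that b(alpha) is an integral combination of b(gamma) and b(w_gamma alpha),
   to which the first case applies.

   The facts on roots that this uses (isotropic roots are orthogonal to R^x,
   the product of the two pairings of non-isotropic roots is between 0 and 4, some
   finite Pi reaches R^x) come from sl_2-theory and the finite rank of the root
   lattice, without positivity of the form. *)
Require Import Defs.
From HB Require Import structures.
From mathcomp Require Import all_boot all_order all_algebra ssrAC.
From mathcomp Require Import sesquilinear complex.
From mathcomp Require Import boolp classical_sets functions cardinality reals.
From mathcomp Require Import zify ring lra.

Set Implicit Arguments.
Unset Strict Implicit.
Unset Printing Implicit Defensive.

Import Order.TTheory GRing.Theory Num.Theory Defs.
Local Open Scope classical_set_scope.
Local Open Scope card_scope.
Local Open Scope ring_scope.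

(** * Integer spans in abelian groups: finite generation and minimal generating sets *)

Section IntegerSpans.
Context {M : zmodType}.
Implicit Types (A B S : set M) (u v : M) (s : seq M).

Lemma zspan_gen A v : A v -> zspan A v.
Proof.
move=> Av; exists 1%N, (fun=> 1), (fun=> v); split=> //.
by rewrite big_ord1 mulr1z.
Qed.

Lemma zspan0 A : zspan A 0.
Proof. by exists 0%N, (fun=> 0), (fun=> 0); split=> [[]//|]; rewrite big_ord0. Qed.

Lemma zspanD A u v : zspan A u -> zspan A v -> zspan A (u + v).
Proof.
move=> [n [c [a [Aa ->]]]] [m [d [b [Ab ->]]]].
exists (n + m)%N, (fun i => match fintype.split i with inl j => c j | inr j => d j end),
  (fun i => match fintype.split i with inl j => a j | inr j => b j end).
split; first by move=> i; case: (fintype.split i).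
rewrite big_split_ord /=; congr (_ + _); apply: eq_bigr => i _.
  by rewrite (unsplitK (inl i)).
by rewrite (unsplitK (inr i)).
Qed.

Lemma zspanMz A v (k : int) : zspan A v -> zspan A (v *~ k).
Proof.
move=> [n [c [a [Aa ->]]]]; exists n, (fun i => c i * k), a; split=> //.
by rewrite mulrz_suml; apply: eq_bigr => i _; rewrite mulrzA.
Qed.

Lemma zspanN A v : zspan A v -> zspan A (- v).
Proof. by move=> /(zspanMz (- 1)); rewrite mulrN1z. Qed.

Lemma zspanB A u v : zspan A u -> zspan A v -> zspan A (u - v).
Proof. by move=> Au Av; apply: zspanD => //; apply: zspanN. Qed.

Lemma zspan_ind A (P : M -> Prop) :
  P 0 -> (forall u v, P u -> P v -> P (u + v)) -> (forall v, P v -> P (- v)) ->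
  (forall v, A v -> P v) -> forall v, zspan A v -> P v.
Proof.
move=> P0 PD PN PA _ [n [c [a [Aa ->]]]].
have Pn u m : P u -> P (u *+ m).
  by move=> Pu; elim: m => [|m IH]; rewrite ?mulr0n // mulrS; apply: PD.
apply: big_ind => // i _; case: (c i) => m; first exact/Pn/PA.
by rewrite NegzE mulrNz; apply/PN/Pn/PA.
Qed.

Lemma zspan_min A B : A `<=` zspan B -> zspan A `<=` zspan B.
Proof.
move=> AB v; apply: zspan_ind => //; first exact: zspan0.
- by move=> *; apply: zspanD.
- by move=> *; apply: zspanN.
Qed.

Lemma zspan_mono A B : A `<=` B -> zspan A `<=` zspan B.
Proof. by move=> AB; apply: zspan_min => v /AB; exact: zspan_gen. Qed.

Lemma zspan_eq A B : A `<=` zspan B -> B `<=` zspan A -> zspan A = zspan B.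
Proof. by move=> AB BA; apply/seteqP; split; apply: zspan_min. Qed.

Lemma zspan_finite_support A v : zspan A v ->
  exists2 s : seq M, [set` s] `<=` A & zspan [set` s] v.
Proof.
move: v; apply: zspan_ind => //.
- by exists [::] => //; apply: zspan0.
- move=> u v [s sA su] [t tA tv]; exists (s ++ t).
    by move=> w /=; rewrite mem_cat => /orP[/sA|/tA].
  by apply: zspanD; [move: su|move: tv]; apply: zspan_mono => w /=;
     rewrite mem_cat => ->; rewrite ?orbT.
- by move=> v [s sA sv]; exists s => //; apply: zspanN.
- move=> v Av; exists [:: v]; first by move=> w /=; rewrite inE => /eqP->.
  by apply: zspan_gen; rewrite /= mem_head.
Qed.

Lemma zspan_seq_support A s : [set` s] `<=` zspan A ->
  exists2 t : seq M, [set` t] `<=` A & [set` s] `<=` zspan [set` t].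
Proof.
elim: s => [|v s IH] sA; first by exists [::].
have [t tA st] : exists2 t : seq M, [set` t] `<=` A & [set` s] `<=` zspan [set` t].
  by apply: IH => w ws; apply: sA; rewrite /= inE ws orbT.
have [u uA vu] : exists2 u : seq M, [set` u] `<=` A & zspan [set` u] v.
  by apply/zspan_finite_support/sA; rewrite /= mem_head.
exists (u ++ t); first by move=> w /=; rewrite mem_cat => /orP[/uA|/tA].
move=> w /=; rewrite inE => /orP[/eqP->|/st]; [move: vu|];
  by apply: zspan_mono => z /=; rewrite mem_cat => ->; rewrite ?orbT.
Qed.

Lemma zspan_range_ordS n (b : 'I_n.+1 -> M) v : zspan (range b) v ->
  exists k : int, zspan (range (b \o lift ord0)) (v - b ord0 *~ k).
Proof.
move: v; apply: zspan_ind.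
- by exists 0; rewrite mulr0z subr0; apply: zspan0.
- by move=> u v [k ku] [l lv]; exists (k + l); rewrite mulrzDr opprD addrACA; apply: zspanD.
- by move=> v [k kv]; exists (- k); rewrite mulrNz opprK addrC -opprB; apply: zspanN.
- move=> _ [i _ <-]; case: (unliftP ord0 i) => [j ->|->].
    by exists 0; rewrite mulr0z subr0; apply: zspan_gen; exists j.
  by exists 1; rewrite mulr1z subrr; apply: zspan0.
Qed.

(** Induction on the number of generators: an element [g] of the span with least positive
    coefficient along [b ord0] reduces the problem to combinations of the other generators. *)
Lemma zspan_noetherian n (b : 'I_n -> M) A : A `<=` zspan (range b) ->
  exists2 s : seq M, [set` s] `<=` A & A `<=` zspan [set` s].
Proof.
elim: n b A => [|n IH] b A Ab.
  exists [::] => // v /Ab; move: v; apply: zspan_ind; first exact: zspan0.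
  - by move=> *; apply: zspanD.
  - by move=> *; apply: zspanN.
  - by move=> v [[]].
pose b' := b \o lift ord0.
(* A relation and not a function: the [b i] may be dependent, so one [v] can have several
   coefficients [k]. *)
pose T k v := zspan A v /\ zspan (range b') (v - b ord0 *~ k).
have T_sub k l u v : T k u -> T l v -> T (k - l) (u - v).
  move=> [Au bu] [Av bv]; split; first exact: zspanB.
  rewrite mulrzBr opprB addrACA (addrC (- v)) addrACA -opprB -(opprB v).
  by rewrite opprB; apply: zspanB.
have T_mul k v q : T k v -> T (k * q) (v *~ q).
  by move=> [Av bv]; split; [|rewrite mulrzA -mulrzBl]; apply: zspanMz.
have T_ex v : zspan A v -> exists k, T k v.
  by move=> Av; case: (zspan_range_ordS (zspan_min Ab Av)) => k; exists k.
case: (pselect (exists d : nat, `[< exists v, T d.+1%:Z v >])) => [exd|nod]; last first.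
  apply: (IH b') => v Av; case: (T_ex v (zspan_gen Av)) => -[[|m]|m] Tv.
  - by case: Tv => _; rewrite mulr0z subr0.
  - by case: nod; exists m; apply/asboolP; exists v.
  - case: nod; exists m; apply/asboolP; exists (v *~ -1).
    by have := T_mul _ _ (-1) Tv; rewrite NegzE mulrN1 opprK.
case: (ex_minnP exd) => d /asboolP[g Tg] min_d.
(* The remainder of the Euclidean division is again a coefficient; being smaller than the least
   positive one, [d.+1], it is zero. *)
have T0 v k : T k v -> T 0 (v - g *~ (k %/ d.+1%:Z)%Z).
  move=> Tv; have := T_sub _ _ _ _ Tv (T_mul _ _ (k %/ d.+1%:Z)%Z Tg).
  have -> : k - d.+1%:Z * (k %/ d.+1%:Z)%Z = (k %% d.+1%:Z)%Z.
    by rewrite {1}(divz_eq k d.+1%:Z) mulrC addrAC subrr add0r.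
  have := modz_ge0 k (d := d.+1%:Z) isT; have := @ltz_pmod k d.+1%:Z isT.
  case: (k %% d.+1%:Z)%Z => // -[//|m] lt_m _ Tm.
  have : (d <= m)%N by apply: min_d; apply/asboolP; eexists; apply: Tm.
  by lia.
have T0b : T 0 `<=` zspan (range b') by move=> v []; rewrite mulr0z subr0.
have [s sA As] := IH b' (T 0) T0b.
have [t tA st] : exists2 t : seq M, [set` t] `<=` A & [set` g :: s] `<=` zspan [set` t].
  by apply: zspan_seq_support => v; rewrite /= inE => /orP[/eqP->|/sA[]//]; case: Tg.
exists t => // v Av; have [k /T0 /As Tv] := T_ex v (zspan_gen Av).
rewrite -(subrK (g *~ (k %/ d.+1%:Z)%Z) v); apply: zspanD.
  by apply: zspan_min Tv => w ws; apply: st; rewrite /= inE ws orbT.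
by apply/zspanMz/st; rewrite /= mem_head.
Qed.

Lemma free_of_minimal_generators (A : set M) k (g : 'I_k -> M) :
  (forall v (m : int), m != 0 -> v *~ m = 0 -> v = 0) ->
  A = zspan (range g) ->
  (forall l (h : 'I_l -> M), A = zspan (range h) -> (k <= l)%N) ->
  forall c : 'I_k -> int, \sum_(i < k) g i *~ c i = 0 -> forall i, c i = 0.
Proof.
move=> tf + min_k c; move: {2}(\sum_i `|c i|)%N (leqnn (\sum_i `|c i|)%N) => N.
elim: N g c => [|N IH] g c leN Ag sum0 i.
  by move: leN; rewrite leqn0 sum_nat_eq0 => /forallP/(_ i); rewrite absz_eq0 => /eqP.
apply/eqP; apply: contraPT isT => ci_neq0; apply/negP.
case: (pselect (exists2 j, j != i & c j != 0)) => [[j0 j0i cj0]|only_i]; last first.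
  have gi0 : g i = 0.
    apply: (tf _ (c i)) => //; move: sum0; rewrite (bigD1 i) //= big1 ?addr0 // => j ji.
    case: (eqVneq (c j) 0) => [->|cj]; first by rewrite mulr0z.
    by case: only_i; exists j.
  case: k i min_k g c leN Ag sum0 ci_neq0 only_i gi0 {IH} => [[]//|k] i min_k g c _ Ag _ _ _ gi0.
  suff /min_k : A = zspan (range (g \o lift i)) by rewrite ltnn.
  rewrite Ag; apply: zspan_eq => _ [j _ <-]; last by apply: zspan_gen; exists (lift i j).
  by case: (unliftP i j) => [l ->|->]; [apply: zspan_gen; exists l|rewrite gi0; apply: zspan0].
have [[p q] /= [pq cp cq le_pq]] : exists pq : 'I_k * 'I_k,
   [/\ pq.1 != pq.2, c pq.1 != 0, c pq.2 != 0 & (`|c pq.2| <= `|c pq.1|)%N].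
  by case/orP: (leq_total `|c i| `|c j0|)%N => ?; [exists (j0, i)|exists (i, j0)]; split=> //=; rewrite eq_sym.
(* The sign makes [c p - e c q] smaller than [c p] in absolute value, as [c q] is non-zero and at
   most [c p] in absolute value. *)
pose e : int := if (0 <= c p) == (0 <= c q) then 1 else -1.
pose g' l := if l == q then g q + g p *~ e else g l.
pose c' l := if l == p then c p - e * c q else c l.
have qp : q != p by rewrite eq_sym.
have lt_c' : (`|c' p| < `|c p|)%N by rewrite /c' eqxx /e; move: cp cq le_pq; clear; case: ifP; lia.
suff : c' q = 0 by rewrite /c' (negPf qp) => /eqP; rewrite (negPf cq).
apply: (IH g').
- rewrite -ltnS; apply: leq_trans leN.
  rewrite (bigD1 p) //= (bigD1 p (F := fun l => `|c l|%N)) //=.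
  rewrite (eq_bigr (fun l => `|c l|%N)) ?ltn_add2r // => l lp.
  by rewrite /c' (negPf lp).
- rewrite Ag; apply: zspan_eq => _ [l _ <-].
    have g'p : g' p = g p by rewrite /g' (negPf pq).
    case: (eqVneq l q) => [->|lq]; last by apply: zspan_gen; exists l => //; rewrite /g' (negPf lq).
    rewrite -[g q](addrK (g p *~ e)) -{2}g'p; apply: zspanB.
      by apply: zspan_gen; exists q => //; rewrite /g' eqxx.
    by apply/zspanMz/zspan_gen; exists p.
  rewrite /g'; case: ifP => _; last by apply: zspan_gen; exists l.
  apply: zspanD; first by apply: zspan_gen; exists q.
  by apply/zspanMz/zspan_gen; exists p.
- rewrite -[RHS]sum0 (bigD1 p) //= (bigD1 q) //= [RHS](bigD1 p) //= [in RHS](bigD1 q) //= !addrA.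
  congr (_ + _); last first.
    by apply: eq_bigr => l /andP[lp lq]; rewrite /g' /c' (negPf lp) (negPf lq).
  rewrite /g' /c' !eqxx (negPf pq) (negPf qp) mulrzBr mulrzDl -mulrzA.
  by rewrite addrACA addNr addr0.
Qed.

Lemma minimal_generators n (g : 'I_n -> M) :
  exists k (h : 'I_k -> M), zspan (range h) = zspan (range g) /\
    forall l (f : 'I_l -> M), zspan (range f) = zspan (range g) -> (k <= l)%N.
Proof.
have exk : exists k, `[< exists h : 'I_k -> M, zspan (range h) = zspan (range g) >].
  by exists n; apply/asboolP; exists g.
case: (ex_minnP exk) => k /asboolP[h hg] min_k; exists k, h; split=> // l f fg.
by apply: min_k; apply/asboolP; exists f.
Qed.

End IntegerSpans.

(** * Lie brackets and iterated adjoint actions *)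

Section LieAlgebras.
Context {K : numFieldType} {E : lieAlgType K}.
Implicit Types (x y z u v e f h : E) (a : K).

Fact lie_linear_r x : linear (lie x).
Proof. by case: (@lie_bilinear _ E) => _ /(_ x). Qed.

HB.instance Definition _ x := GRing.isLinear.Build K E E *:%R (lie x) (lie_linear_r x).

Lemma lieDl x y z : lie (x + y) z = lie x z + lie y z.
Proof. by case: (@lie_bilinear _ E) => /(_ z) /(_ 1 x y) /=; rewrite !scale1r. Qed.

Lemma lieC x y : lie x y = - lie y x.
Proof.
apply/eqP; rewrite -addr_eq0; have := lie_xx (x + y).
by rewrite lieDl !linearD /= !lie_xx add0r addr0 => ->.
Qed.

Lemma lieZl a x y : lie (a *: x) y = a *: lie x y.
Proof. by rewrite lieC linearZ /= -scalerN -lieC. Qed.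

Lemma lieNl x y : lie (- x) y = - lie x y.
Proof. by rewrite lieC linearN /= opprK -lieC. Qed.

Lemma lie0l x : lie 0 x = 0.
Proof. by rewrite lieC linear0 oppr0. Qed.

Lemma lieMzl x y (m : int) : lie (x *~ m) y = lie x y *~ m.
Proof. by rewrite -!scaler_int lieZl. Qed.

Lemma lieMzr x y (m : int) : lie x (y *~ m) = lie x y *~ m.
Proof. by rewrite -!scaler_int linearZ. Qed.

Lemma lie_sumr x (I : Type) (r : seq I) (P : pred I) (F : I -> E) :
  lie x (\sum_(i <- r | P i) F i) = \sum_(i <- r | P i) lie x (F i).
Proof. exact: linear_sum. Qed.

Lemma lie_suml x (I : Type) (r : seq I) (P : pred I) (F : I -> E) :
  lie (\sum_(i <- r | P i) F i) x = \sum_(i <- r | P i) lie (F i) x.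
Proof. by rewrite lieC lie_sumr -sumrN; apply: eq_bigr => i _; rewrite -lieC. Qed.

Lemma lie_leibniz x y z : lie x (lie y z) = lie (lie x y) z + lie y (lie x z).
Proof.
apply/eqP; rewrite -subr_eq0 -(lie_jacobi x y z) opprD addrA (lieC (lie x y) z) opprK.
by rewrite addrAC (lieC x z) linearN opprK addrAC.
Qed.

Lemma iter_lie0 x n : iter n (lie x) 0 = 0.
Proof. by elim: n => //= n ->; rewrite linear0. Qed.

Lemma iter_lie_linear x n a u v :
  iter n (lie x) (a *: u + v) = a *: iter n (lie x) u + iter n (lie x) v.
Proof. by elim: n => //= n ->; rewrite linearP. Qed.

Lemma iter_lie_ge x n m v : (n <= m)%N -> iter n (lie x) v = 0 -> iter m (lie x) v = 0.
Proof. by move=> /subnK<- nv; rewrite iterD nv iter_lie0. Qed.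

Definition ad_nilpotent x := forall y, exists n, iter n (lie x) y = 0.

Lemma ad_nilpotentN x : ad_nilpotent x -> ad_nilpotent (- x).
Proof.
move=> nx y; have [n ny] := nx y; exists n.
suff -> : iter n (lie (- x)) y = (- 1) ^+ n *: iter n (lie x) y by rewrite ny scaler0.
by elim: {ny} n => [|n /= ->]; rewrite ?scale1r // lieNl linearZ exprS mulN1r scaleNr.
Qed.

Lemma last_nonzero_iter x v : v != 0 -> (exists n, iter n (lie x) v = 0) ->
  exists n, iter n (lie x) v != 0 /\ iter n.+1 (lie x) v = 0.
Proof.
move=> v0 nv0; have exn : exists n, iter n (lie x) v == 0.
  by case: nv0 => n nv; exists n; apply/eqP.
case: (ex_minnP exn) => -[|n] nv min_n; first by rewrite -[v]/(iter 0 (lie x) v) nv in v0.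
exists n; split; last exact/eqP.
by apply/negP => /min_n; rewrite ltnn.
Qed.

(** The weights [w] are left arbitrary, so that the formula serves both the strings of an
    sl_2-triple and the ladder of an isotropic root, on which [w] is constant. *)
Lemma lie_iter_step x y h v (w : nat -> K) mu :
  lie x y = h -> lie x (lie y v) = mu *: v ->
  (forall k, lie h (iter k (lie y) v) = w k *: iter k (lie y) v) ->
  forall k, lie x (iter k.+1 (lie y) v) =
    (mu + \sum_(1 <= j < k.+1) w j) *: iter k (lie y) v.
Proof.
move=> xy xyv hw; elim=> [|k IH]; first by rewrite big_geq // addr0.
rewrite iterS lie_leibniz xy IH hw linearZ /= -scalerDl [in RHS]big_nat_recr //=.
by rewrite addrCA; congr ((_ + _) *: _); rewrite addrC.
Qed.

Lemma lie_iter_weight x h v a b : lie h x = a *: x -> lie h v = b *: v ->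
  forall k, lie h (iter k (lie x) v) = (b + a *+ k) *: iter k (lie x) v.
Proof.
move=> hx hv; elim=> [|k IH]; first by rewrite addr0.
by rewrite iterS lie_leibniz hx IH lieZl linearZ /= -iterS -scalerDl mulrS addrCA.
Qed.

(** * sl_2-triples: string lengths and highest weights *)

Definition sl2_triple e f h :=
  [/\ lie e f = h, lie h e = 2 *: e & lie h f = - 2 *: f].

Lemma sl2_tripleC e f h : sl2_triple e f h -> sl2_triple f e (- h).
Proof.
case=> ef he hf; split; first by rewrite lieC ef.
- by rewrite lieNl hf scaleNr opprK.
- by rewrite lieNl he scaleNr.
Qed.

Lemma sumr_arith n (a b : K) :
  2 * (\sum_(1 <= j < n.+1) (a + j%:R * b)) = n%:R * (2 * a + (n%:R + 1) * b).
Proof.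
elim: n => [|n IH]; first by rewrite big_geq // mulr0 mul0r.
by rewrite big_nat_recr //= mulrDr IH -natr1; ring.
Qed.

Lemma sl2_string e f h y p mu q : sl2_triple e f h ->
  lie h y = p *: y -> lie f (lie e y) = mu *: y ->
  iter q (lie e) y != 0 -> iter q.+1 (lie e) y = 0 ->
  mu = q%:R * (p + q%:R + 1).
Proof.
move=> [ef he hf] hy fey q0 q1.
have fe : lie f e = - h by rewrite lieC ef.
have hw k : lie (- h) (iter k (lie e) y) = (- p + k%:R * - 2) *: iter k (lie e) y.
  by rewrite lieNl (lie_iter_weight he hy) -scaleNr -[2 *+ k]mulr_natl opprD mulrN.
have := lie_iter_step fe fey hw q.
rewrite q1 linear0 => /esym/eqP; rewrite scaler_eq0 (negPf q0) orbF => /eqP.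
have := sumr_arith q (- p) (- 2); move: (\sum_(_ <= _ < _) _) => s s2 mus.
have two0 : (2 : K) != 0 by rewrite pnatr_eq0.
apply: (mulfI two0); rewrite -[mu](addrK s) mus sub0r mulrN s2; ring.
Qed.

(* Lowering a highest weight vector terminates only after an integral number
   of steps, so the weight is a natural number. *)
Lemma sl2_highest_weight e f h v p : sl2_triple e f h -> ad_nilpotent f ->
  v != 0 -> lie e v = 0 -> lie h v = p *: v ->
  exists2 n, p = n%:R & forall k, (k <= n)%N -> iter k (lie f) v != 0.
Proof.
move=> sl2 nf v0 ev hv; have [n [n0 n1]] := last_nonzero_iter v0 (nf v).
exists n; last first.
  by move=> k kn; apply: contraNneq n0 => /(iter_lie_ge kn) ->.
have hv' : lie (- h) v = (- p) *: v by rewrite lieNl hv scaleNr.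
have ef0 : lie e (lie f v) = p *: v.
  by case: sl2 => ef _ _; rewrite lie_leibniz ef ev linear0 addr0.
(* Here e f v = p v, so the string formula for the opposite triple reads p = n (-p + n + 1), that is
   (n + 1) (p - n) = 0. *)
have := sl2_string (sl2_tripleC sl2) hv' ef0 n0 n1 => peq.
have : (n%:R + 1) * (p - n%:R) = 0 :> K by transitivity (p - n%:R * (- p + n%:R + 1)); [ring|rewrite -peq subrr].
by move/eqP; rewrite mulf_eq0 natr1 pnatr_eq0 /= subr_eq0 => /eqP.
Qed.

Lemma sl2_highest_weight_ge0 e f h v p : sl2_triple e f h -> ad_nilpotent f ->
  lie e v = 0 -> lie h v = p *: v -> p < 0 -> v = 0.
Proof.
move=> sl2 nf ev hv p0; apply/eqP; apply: contraLR p0 => v0.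
have [n -> _] := sl2_highest_weight sl2 nf v0 ev hv.
by rewrite le_gtF ?ler0n.
Qed.

(** * Exponentials of locally nilpotent inner derivations *)

Section Exponential.
Variable x : E.

(** The divided power of [ad x]; for these the Leibniz rule has no binomial coefficients. *)
Let dp k y : E := (k`!%:R)^-1 *: iter k (lie x) y.

Let dp0 y : dp 0 y = y.
Proof. by rewrite /dp fact0 invr1 scale1r. Qed.

Let dpS k y : lie x (dp k y) = k.+1%:R *: dp k.+1 y.
Proof.
rewrite /dp linearZ /= scalerA factS natrM invfM mulrA divff ?mul1r //.
by rewrite pnatr_eq0.
Qed.

Let dp_eq0 k y : iter k (lie x) y = 0 -> dp k y = 0.
Proof. by rewrite /dp => ->; rewrite scaler0. Qed.

Let dp_ge n k y : (n <= k)%N -> iter n (lie x) y = 0 -> dp k y = 0.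
Proof. by move=> nk /(iter_lie_ge nk)/dp_eq0. Qed.

(** Induction after multiplication by k + 1: the two terms of the Leibniz rule contribute the
    weights i and k + 1 - i to each summand. *)
Let dp_lie k u v : dp k (lie u v) = \sum_(i < k.+1) lie (dp i u) (dp (k - i) v).
Proof.
elim: k => [|k IH]; first by rewrite big_ord1 !dp0.
have k0 : k.+1%:R != 0 :> K by rewrite pnatr_eq0.
apply: (scalerI k0); rewrite -dpS IH lie_sumr.
transitivity (\sum_(i < k.+2) (i%:R *: lie (dp i u) (dp (k.+1 - i) v)) +
              \sum_(i < k.+2) ((k.+1 - i)%:R *: lie (dp i u) (dp (k.+1 - i) v))).
  rewrite [X in X + _]big_ord_recl scale0r add0r [X in _ + X]big_ord_recr /= subnn scale0r addr0.
  rewrite -big_split /=; apply: eq_bigr => i _; rewrite /bump /= add1n subSS.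
  rewrite lie_leibniz !dpS lieZl linearZ /=; congr (_ + _).
by rewrite -subSn ?leq_ord // linearZ.
rewrite scaler_sumr -big_split /=; apply: eq_bigr => i _.
by rewrite -scalerDl -natrD subnKC // -ltnS.
Qed.

(** The number of summands is any exponent that annihilates [y]; [exp_adE] shows that the value does
    not depend on it. *)
Definition exp_ad y : E :=
  \sum_(k < xget 0%N [set n | iter n (lie x) y = 0]) dp k y.

Let sum_dp_ge n m y : (n <= m)%N -> iter n (lie x) y = 0 ->
  \sum_(k < m) dp k y = \sum_(k < n) dp k y.
Proof.
move=> /subnKC<- ny; rewrite big_split_ord /= [X in _ + X]big1 ?addr0 // => i _.
by apply: dp_ge ny; rewrite leq_addr.
Qed.

Lemma exp_adE n y : iter n (lie x) y = 0 ->
  exp_ad y = \sum_(k < n) (k`!%:R)^-1 *: iter k (lie x) y.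
Proof.
move=> ny; rewrite /exp_ad; case: xgetP => [m _ my|/(_ n)//].
by case: (leqP n m) => [nm|/ltnW mn]; [apply: sum_dp_ge|apply/esym/sum_dp_ge].
Qed.

Hypothesis nx : ad_nilpotent x.

Let nilp2 u v : exists n, iter n (lie x) u = 0 /\ iter n (lie x) v = 0.
Proof.
case: (nx u) (nx v) => n nu [m mv]; exists (n + m)%N.
by split; [apply: iter_lie_ge nu; rewrite leq_addr|apply: iter_lie_ge mv; rewrite leq_addl].
Qed.

Lemma exp_ad_linear : linear exp_ad.
Proof.
move=> a u v; have [n [nu nv]] := nilp2 u v.
rewrite (exp_adE nu) (exp_adE nv) (@exp_adE n); last by rewrite iter_lie_linear nu nv scaler0 addr0.
rewrite scaler_sumr -big_split /=; apply: eq_bigr => k _.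
by rewrite iter_lie_linear scalerDr !scalerA mulrC.
Qed.

Let triangular_sum (F : nat -> nat -> E) m :
  \sum_(k < m) \sum_(i < k.+1) F i (k - i)%N = \sum_(i < m) \sum_(j < m - i) F i j.
Proof.
elim: m => [|m IH]; first by rewrite !big_ord0.
rewrite big_ord_recr /= IH [RHS]big_ord_recr /= subSn // subnn big_ord1.
rewrite [in LHS]big_ord_recr /= subnn addrA; congr (_ + _).
rewrite -big_split /=; apply: eq_bigr => i _.
by rewrite subSn ?big_ord_recr // ltnW.
Qed.

(** Both sides are sums over pairs (i, j), the left one over i + j < 2 n and the right one over i, j
    < n; the terms with i >= n or j >= n vanish. *)
Lemma exp_ad_lie u v : exp_ad (lie u v) = lie (exp_ad u) (exp_ad v).
Proof.
have [n [nu nv]] := nilp2 u v.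
have dp_uv i j : (n <= i)%N || (n <= j)%N -> lie (dp i u) (dp j v) = 0.
  by case/orP => ?; [rewrite (@dp_ge n i) ?lie0l|rewrite (@dp_ge n j) ?linear0].
rewrite (exp_adE nu) (exp_adE nv) (@exp_adE (n + n)%N); last first.
  have k0 : ((n + n)`!%:R : K)^-1 != 0 by rewrite invr_eq0 pnatr_eq0 -lt0n fact_gt0.
  apply: (scalerI k0); rewrite scaler0 -/(dp _ _) dp_lie big1 // => i _.
  by apply: dp_uv; case: (leqP n i) => //= ?; lia.
transitivity (\sum_(k < n + n) \sum_(i < k.+1) lie (dp i u) (dp (k - i)%N v)).
  by apply: eq_bigr => k _; rewrite -/(dp _ _) dp_lie.
rewrite (triangular_sum (fun i j => lie (dp i u) (dp j v))) big_split_ord /= [X in _ + X]big1 ?addr0; last first.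
  by move=> i _; rewrite big1 // => j _; apply: dp_uv; rewrite leq_addr.
rewrite lie_suml; apply: eq_bigr => i _; rewrite lie_sumr.
have -> : (n + n - i = n + (n - i))%N by have := ltn_ord i; lia.
rewrite big_split_ord /= [X in _ + X]big1 ?addr0 // => j _.
by apply: dp_uv; rewrite leq_addr orbT.
Qed.

(** If the difference of [u] and [v] were non-zero, the last power of [ad x] not annihilating it,
    applied to its exponential, would leave only the constant term. *)
Lemma exp_ad_inj u v : exp_ad u = exp_ad v -> u = v.
Proof.
move=> uv; apply/eqP; rewrite -subr_eq0; apply: contraPT isT => w0; apply/negP.
have [n [n0 n1]] := last_nonzero_iter w0 (nx _).
have iter_add w z : iter n (lie x) (w + z) = iter n (lie x) w + iter n (lie x) z.
  by rewrite -[w]scale1r iter_lie_linear !scale1r.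
have : exp_ad (u - v) = 0 by rewrite addrC -scaleN1r exp_ad_linear uv scaleN1r addNr.
rewrite (exp_adE n1) big_ord_recl /= fact0 invr1 scale1r => /(congr1 (iter n (lie x))).
rewrite iter_add iter_lie0 [X in _ + X](_ : _ = 0) ?addr0; first by move=> n2; rewrite n2 eqxx in n0.
apply: (big_ind (fun z => iter n (lie x) z = 0)); first exact: iter_lie0.
  by move=> w z nw nz; rewrite iter_add nw nz addr0.
move=> i _; rewrite -[X in iter n _ X]addr0 iter_lie_linear iter_lie0 addr0.
rewrite -[lie x _]/(iter (bump 0 i) (lie x) _) -iterD.
by rewrite (iter_lie_ge _ n1) ?scaler0 // /bump; lia.
Qed.

End Exponential.

(* If [phi] maps [ad x] to [ad x'] on a subspace [C] stable under [ad x], it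
   maps [exp (ad x)] to [exp (ad x')] there; [phi] need not be linear outside [C]. *)
Lemma exp_ad_intertwine (C : set E) (phi : E -> E) x x' :
  submod_closed [in C] ->
  (forall a u v, C u -> C v -> phi (a *: u + v) = a *: phi u + phi v) ->
  (forall y, C y -> C (lie x y)) ->
  (forall y, C y -> phi (lie x y) = lie x' (phi y)) ->
  ad_nilpotent x -> forall y, C y -> C (exp_ad x y) /\ phi (exp_ad x y) = exp_ad x' (phi y).
Proof.
move=> [C0 Clin] phi_lin Cx phix nx y Cy.
have C_lin a u v : C u -> C v -> C (a *: u + v).
  by move=> Cu Cv; apply/set_mem/Clin; rewrite inE.
have {}C0 : C 0 by apply/set_mem.
have phi0 : phi 0 = 0.
  by have := phi_lin (- 1) 0 0 C0 C0; rewrite scaler0 addr0 scaleN1r addNr.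
have Citer k : C (iter k (lie x) y) /\ phi (iter k (lie x) y) = iter k (lie x') (phi y).
  by elim: k => //= k [Ck phik]; split; [exact: Cx|rewrite phix // phik].
have [n ny] := nx y.
have ny' : iter n (lie x') (phi y) = 0 by have [_ <-] := Citer n; rewrite ny.
rewrite (exp_adE ny) (exp_adE ny').
elim: n {ny ny'} => [|n [IHC IH]]; first by rewrite !big_ord0.
have [Cn phin] := Citer n.
by rewrite !big_ord_recr /= addrC [X in _ = X]addrC; split; [exact: C_lin|rewrite phi_lin // phin IH].
Qed.

Lemma exp_ad2 x y : lie x y = 0 -> exp_ad x y = y.
Proof. by move=> xy; rewrite (@exp_adE _ 1%N) // big_ord1 fact0 invr1 scale1r. Qed.

Lemma exp_ad3 x y : lie x (lie x y) = 0 -> exp_ad x y = y + lie x y.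
Proof.
by move=> xy; rewrite (@exp_adE _ 2%N) // !big_ord_recr big_ord0 /= add0r !factS fact0 invr1 !scale1r.
Qed.

Lemma exp_ad4 x y : lie x (lie x (lie x y)) = 0 ->
  exp_ad x y = y + lie x y + 2^-1 *: lie x (lie x y).
Proof.
by move=> xy; rewrite (@exp_adE _ 3%N) // !big_ord_recr big_ord0 /= add0r !factS fact0 invr1 !scale1r.
Qed.

(** * The inner automorphism attached to an sl_2-triple *)

Section SimpleReflection.
Variables e f h : E.
Hypotheses (sl2 : sl2_triple e f h) (ne : ad_nilpotent e) (nf : ad_nilpotent (- f)).

(** The action of the element of SL_2 with rows (0, 1) and (-1, 0), which represents the non-trivial
    element of the Weyl group. *)
Definition reflection_aut v := exp_ad e (exp_ad (- f) (exp_ad e v)).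

Let ef : lie e f = h. Proof. by case: sl2. Qed.
Let fe : lie f e = - h. Proof. by rewrite lieC ef. Qed.
Let he : lie h e = 2 *: e. Proof. by case: sl2. Qed.
Let eh : lie e h = - 2 *: e. Proof. by rewrite lieC he scaleNr. Qed.
Let fh : lie f h = 2 *: f.
Proof. by case: sl2 => _ _ hf; rewrite lieC hf scaleNr opprK. Qed.

Lemma reflection_aut_linear : linear reflection_aut.
Proof. by move=> a u v; rewrite /reflection_aut !exp_ad_linear. Qed.

Lemma reflection_aut_lie u v :
  reflection_aut (lie u v) = lie (reflection_aut u) (reflection_aut v).
Proof. by rewrite /reflection_aut !exp_ad_lie. Qed.

Let expE_lin := exp_ad_linear ne.
Let expF_lin := exp_ad_linear nf.

Let expFD u v : exp_ad (- f) (u + v) = exp_ad (- f) u + exp_ad (- f) v.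
Proof. by rewrite -[u]scale1r expF_lin !scale1r. Qed.
Let expFZ a u : exp_ad (- f) (a *: u) = a *: exp_ad (- f) u.
Proof.
have expF0 : exp_ad (- f) 0 = 0 by apply: exp_ad2; rewrite linear0.
by rewrite -[a *: u]addr0 expF_lin expF0 addr0.
Qed.
Let expED u v : exp_ad e (u + v) = exp_ad e u + exp_ad e v.
Proof. by rewrite -[u]scale1r expE_lin !scale1r. Qed.
Let expEZ a u : exp_ad e (a *: u) = a *: exp_ad e u.
Proof.
have expE0 : exp_ad e 0 = 0 by apply: exp_ad2; rewrite linear0.
by rewrite -[a *: u]addr0 expE_lin expE0 addr0.
Qed.

Let expEe : exp_ad e e = e. Proof. by apply: exp_ad2; rewrite lie_xx. Qed.
Let expFf : exp_ad (- f) f = f. Proof. by apply: exp_ad2; rewrite lieNl lie_xx oppr0. Qed.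
Let expEf : exp_ad e f = f + h - e.
Proof.
rewrite exp_ad4 ?ef ?eh; last by rewrite linearZ /= lie_xx scaler0.
by rewrite scalerA mulrN mulVf ?scaleN1r // pnatr_eq0.
Qed.
Let expFe : exp_ad (- f) e = e + h - f.
Proof.
have Fe : lie (- f) e = h by rewrite lieNl fe opprK.
have Fh : lie (- f) h = - 2 *: f by rewrite lieNl fh scaleNr.
rewrite exp_ad4 Fe Fh; last by rewrite lieNl linearZ /= lie_xx scaler0 oppr0.
by rewrite scalerA mulrN mulVf ?scaleN1r // pnatr_eq0.
Qed.

Let expEk k (c : K) : lie e k = - c *: e -> exp_ad e k = k - c *: e.
Proof. by move=> ek; rewrite exp_ad3 ek ?scaleNr // linearN linearZ /= lie_xx scaler0 oppr0. Qed.
Let expFk k (c : K) : lie f k = c *: f -> exp_ad (- f) k = k - c *: f.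
Proof.
move=> fk; have Fk : lie (- f) k = - c *: f by rewrite lieNl fk scaleNr.
by rewrite exp_ad3 Fk ?scaleNr // lieNl linearN linearZ /= lie_xx scaler0 !oppr0.
Qed.

Lemma reflection_aut_f : reflection_aut f = - e.
Proof.
rewrite /reflection_aut expEf -[- e]scaleN1r !expFD expFf (@expFk _ 2) // expFZ expFe.
rewrite (_ : _ + _ = - 1 *: e) ?expEZ ?expEe //.
rewrite !scaleN1r scaler_nat mulr2n !opprD !opprK !addrA.
by rewrite [LHS](AC 7 ((1*3)*(2*6)*(7*4)*5)) /= !subrr !add0r.
Qed.

Lemma reflection_aut_cartan k (c : K) : lie e k = - c *: e -> lie f k = c *: f ->
  reflection_aut k = k - c *: h.
Proof.
move=> ek fk; rewrite /reflection_aut (expEk ek) -scaleNr expFD expFZ (expFk fk) expFe.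
have -> : k - c *: f + - c *: (e + h - f) = k + - c *: e + - c *: h.
  rewrite scalerBr scalerDr [- c *: f]scaleNr opprK !addrA.
  by rewrite [LHS](AC 5 ((1*3*4)*(2*5))) /= addNr addr0.
rewrite !expED !expEZ (expEk ek) expEe (@expEk h 2) //.
rewrite scalerBr scalerA mulNr !scaleNr opprK mulr_natr mulr2n scalerDl !addrA.
by rewrite [LHS](AC 6 ((1*4)*(2*5)*(3*6))) /= !addNr !addr0.
Qed.

(* Since the automorphism sends [f] to [- e], it conjugates [exp (ad (- f))]
   to [exp (ad e)]; cancelling the injective [exp (ad e)] exchanges the roles
   of [e] and [- f]. *)
Lemma reflection_aut_sym v :
  exp_ad (- f) (exp_ad e (exp_ad (- f) v)) = reflection_aut v.
Proof.
apply: (exp_ad_inj ne); rewrite -[LHS]/(reflection_aut (exp_ad (- f) v)).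
have autFe : reflection_aut (- f) = e.
  by rewrite -scaleN1r -[- 1 *: f]addr0 reflection_aut_linear reflection_aut_f;
     rewrite /reflection_aut !exp_ad2 ?linear0 ?addr0 ?scaleN1r ?opprK.
have [] // := @exp_ad_intertwine setT reflection_aut (- f) e _ _ _ _ nf v I.
- by split; [rewrite inE|move=> a u w _ _; rewrite inE].
- by move=> a u w _ _; exact: reflection_aut_linear.
- by move=> y _; rewrite reflection_aut_lie autFe.
Qed.

(** The relation f f e z = 2 f z closes the computation: f (2 z - f e z) is annihilated by [ad e]
    and has weight -2, so it is zero. *)
Lemma reflection_aut_weight0 z : lie h z = 0 ->
  lie e (lie e z) = 0 -> lie f (lie f z) = 0 ->
  reflection_aut z = z - lie f (lie e z).
Proof.
move=> hz eez ffz; pose z1 := lie e z; pose z2 := lie f z1.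
have two0 : (2 : K) != 0 by rewrite pnatr_eq0.
have hz1 : lie h z1 = 2 *: z1 by rewrite lie_leibniz he hz linear0 addr0 lieZl.
have ez2 : lie e z2 = 2 *: z1 by rewrite lie_leibniz ef hz1 eez linear0 addr0.
have hz2 : lie h z2 = 0.
  rewrite lie_leibniz hz1; case: sl2 => _ _ ->.
  by rewrite lieZl linearZ /= -scalerDl addNr scale0r.
pose w := lie f (2 *: z - z2).
have w0 : w = 0.
  apply: (sl2_highest_weight_ge0 (p := - 2) sl2).
  - by rewrite -[f]opprK; exact: ad_nilpotentN.
  - rewrite lie_leibniz ef linearB linearZ /= hz hz2 scaler0 subr0 add0r.
    by rewrite linearB linearZ /= ez2 subrr linear0.
  - rewrite lie_leibniz [lie h (_ - _)]linearB linearZ /= hz hz2 scaler0 subr0 linear0 addr0.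
    by case: sl2 => _ _ ->; rewrite lieZl.
  - by rewrite oppr_lt0 ltr0n.
have fz2 : lie f z2 = 2 *: lie f z by move/eqP: w0; rewrite /w linearB linearZ /= subr_eq0 => /eqP.
have Fz : exp_ad (- f) z = z - lie f z.
  by rewrite exp_ad3 !lieNl // [lie f (- _)]linearN /= ffz !oppr0.
have Fz1 : exp_ad (- f) z1 = z1 - z2 + lie f z.
  have fffz1 : lie f (lie f z2) = 0 by rewrite fz2 linearZ /= ffz scaler0.
  have FF y : lie (- f) (lie (- f) y) = lie f (lie f y).
    by rewrite !lieNl [lie f (- _)]linearN opprK.
  rewrite exp_ad4; last by rewrite FF lieNl -/z2 -[- z2]scaleN1r !linearZ /= fffz1 scaler0.
  rewrite FF lieNl -/z2.
  by rewrite fz2 scalerA mulVf // scale1r.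
rewrite /reflection_aut (exp_ad3 eez) expFD Fz Fz1.
have -> : z - lie f z + (z1 - z2 + lie f z) = z + z1 - z2.
  by rewrite !addrA [LHS](AC 5 (((1*3)*4)*(2*5))) /= addNr addr0.
have Ez2 : exp_ad e z2 = z2 + 2 *: z1.
  by rewrite exp_ad3 ez2 // linearZ /= eez scaler0.
rewrite !expED -[- z2]scaleN1r expEZ (exp_ad3 eez) (exp_ad2 eez) Ez2 -/z1.
rewrite !scaleN1r scaler_nat mulr2n !opprD !addrA.
by rewrite [LHS](AC 6 ((1*4)*(2*5)*(3*6))) /= !subrr !addr0.
Qed.

End SimpleReflection.

End LieAlgebras.

(** * Root spaces, the form on them, and the functionals represented by [t_] *)

Section RootSpaces.
Context {R : realType} (E : eala R).
Implicit Types (alpha beta sigma : dual_cartan E) (h k : cartan E) (u v w : E).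

Lemma dual_addE alpha beta h : (alpha + beta) h = alpha h + beta h.
Proof. exact: add_lfunE. Qed.
Lemma dual_oppE alpha h : (- alpha) h = - alpha h.
Proof. exact: opp_lfunE. Qed.
Lemma dual_scaleE (c : R[i]) alpha h : (c *: alpha) h = c * alpha h.
Proof. exact: scale_lfunE. Qed.
Lemma dual_zeroE h : (0 : dual_cartan E) h = 0.
Proof. exact: zero_lfunE. Qed.
Lemma dual_mulzE alpha (m : int) h : (alpha *~ m) h = m%:~R * alpha h.
Proof. by rewrite -scaler_int dual_scaleE. Qed.

Lemma root_space0 alpha : root_space alpha (0 : E).
Proof. by move=> h; rewrite linear0 scaler0. Qed.

Lemma root_spaceP alpha (c : R[i]) u v :
  root_space alpha u -> root_space alpha v -> root_space alpha (c *: u + v).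
Proof. by move=> au av h; rewrite linearP /= au av scalerDr !scalerA mulrC. Qed.

Lemma root_spaceZ alpha (c : R[i]) u : root_space alpha u -> root_space alpha (c *: u).
Proof. by move=> au; rewrite -[_ *: _]addr0; apply: root_spaceP au (root_space0 _). Qed.

Lemma root_spaceD alpha u v :
  root_space alpha u -> root_space alpha v -> root_space alpha (u + v).
Proof. by move=> au; rewrite -[u]scale1r; exact: root_spaceP. Qed.

Lemma root_spaceN alpha u : root_space alpha u -> root_space alpha (- u).
Proof. by rewrite -scaleN1r; exact: root_spaceZ. Qed.

Lemma root_space_lie alpha beta u v :
  root_space alpha u -> root_space beta v -> root_space (alpha + beta) (lie u v).
Proof.
move=> au bv h; rewrite lie_leibniz au bv lieZl linearZ /= -scalerDl.
by rewrite dual_addE.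
Qed.

Lemma root_space_iter alpha beta u v n :
  root_space alpha u -> root_space beta v ->
  root_space (beta + alpha *+ n) (iter n (lie u) v).
Proof.
move=> au bv; elim: n => [|n IH]; first by rewrite addr0.
by rewrite mulrS addrCA; exact: root_space_lie.
Qed.

Lemma root_space_inj alpha beta u :
  root_space alpha u -> root_space beta u -> u != 0 -> alpha = beta.
Proof.
move=> au bu u0; apply/lfunP => h; apply/eqP; rewrite -subr_eq0.
have /eqP : (alpha h - beta h) *: u = 0 by rewrite scalerBl -au -bu subrr.
by rewrite scaler_eq0 (negPf u0) orbF.
Qed.

Lemma root_space_root alpha u : root_space alpha u -> u != 0 -> roots E alpha.
Proof. by move=> au u0; exists u. Qed.

Lemma root_space_nonroot alpha u : ~ roots E alpha -> root_space alpha u -> u = 0.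
Proof.
by move=> na au; apply/eqP; apply: contraPT isT => u0 _; apply: na; exists u.
Qed.

Lemma formC u v : form E u v = form E v u.
Proof. exact: (form_sym (ealaP E)). Qed.

Lemma form_lie u v w : form E (lie u v) w = form E u (lie v w).
Proof. exact: (form_invariant (ealaP E)). Qed.

Lemma form_root_spaces alpha beta u v : root_space alpha u -> root_space beta v ->
  alpha + beta != 0 -> form E u v = 0.
Proof.
move=> au bv; apply: contraNeq => uv0; apply/eqP/lfunP => h.
rewrite dual_addE dual_zeroE; apply: (mulIf uv0); rewrite mul0r mulrDl.
have := form_lie u (incl E h) v.
rewrite lieC au bv linearNl linearZl_LR linearZr_LR /= => <-.
exact: addrN.
Qed.

(** Only the component of weight [- alpha] of a vector can pair with [u], so non-degeneracy on [E]
    provides a partner there. *)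
Lemma root_space_dual alpha u : root_space alpha u -> u != 0 ->
  exists2 v, root_space (- alpha) v & form E u v = 1.
Proof.
move=> au u0; have [v av uv] : exists2 v, root_space (- alpha) v & form E u v != 0.
  apply/not_exists2P => nv; case/eqP: u0; apply: (form_nondegenerate (ealaP E)) => y.
  have [n [beta [z [bz ->]]]] := root_decomposition (ealaP E) y.
  rewrite linear_sum /= big1 // => i _; apply/eqP; apply: contraPT isT => uz _.
  have [|b0] := eqVneq (alpha + beta i) 0.
    move/eqP; rewrite addrC addr_eq0 => /eqP bi; have := bz i; rewrite bi => az.
    by case: (nv (z i)) => // /negP; rewrite negbK => /eqP z0; rewrite z0 eqxx in uz.
  by rewrite (form_root_spaces au (bz i) b0) eqxx in uz.
exists ((form E u v)^-1 *: v); first exact: root_spaceZ.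
by rewrite linearZr_LR /= mulVf.
Qed.

Lemma root_space0E : root_space 0 = range (incl E).
Proof. exact: (zero_root_space (ealaP E)). Qed.

Lemma root_space_incl h : root_space 0 (incl E h).
Proof. by rewrite root_space0E; exists h. Qed.

Lemma incl_eq0 h : (incl E h == 0) = (h == 0).
Proof.
apply/eqP/eqP => [|->]; last exact: linear0.
by rewrite -(linear0 (incl E)); exact: (incl_inj (ealaP E)).
Qed.

(** The partner of [incl E h] given by [root_space_dual] has weight zero, hence lies in the image of
    the Cartan subalgebra. *)
Lemma cartan_form_nondegenerate h : (forall k, form E (incl E k) (incl E h) = 0) -> h = 0.
Proof.
move=> h0; apply/eqP; rewrite -incl_eq0; apply: contraPT isT => ih0 _.
have [v] := root_space_dual (root_space_incl h) ih0.
rewrite oppr0 root_space0E => -[k _ <-]; rewrite formC h0 => /esym/eqP.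
by rewrite oner_eq0.
Qed.

(** The defining property of [t_ alpha], as opposed to its default value; it holds for roots and
    passes to their integral combinations. *)
Definition represented alpha := forall h, alpha h = form E (incl E h) (incl E (t_ alpha)).

Lemma t_unique alpha k : (forall h, alpha h = form E (incl E h) (incl E k)) ->
  t_ alpha = k /\ represented alpha.
Proof.
move=> ak; suff ta : t_ alpha = k by split=> // h; rewrite ta.
rewrite /t_; case: xgetP => [t _ /= at_|/(_ k) /= nk]; last by case: nk.
apply/eqP; rewrite -subr_eq0; apply/eqP/cartan_form_nondegenerate => h.
by rewrite linearB linearBr /= -ak -at_ subrr.
Qed.

Lemma t_lin (c : R[i]) alpha beta : represented alpha -> represented beta ->
  t_ (c *: alpha + beta) = c *: t_ alpha + t_ beta /\ represented (c *: alpha + beta).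
Proof.
move=> ra rb; apply: t_unique => h.
rewrite dual_addE dual_scaleE ra rb linearP /= linearDr linearZr_LR /=.
by [].
Qed.

Lemma root_space_lie_opp alpha u v : represented alpha ->
  root_space alpha u -> root_space (- alpha) v ->
  lie u v = form E u v *: incl E (t_ alpha).
Proof.
move=> ra au av; have := root_space_lie au av; rewrite subrr root_space0E => -[k _ uvk].
rewrite -uvk -linearZ; congr (incl E _); apply/eqP; rewrite -subr_eq0; apply/eqP.
apply: cartan_form_nondegenerate => h; rewrite linearB linearBr /= uvk -form_lie au.
by rewrite linearZ linearZr_LR linearZl_LR /= -ra mulrC subrr.
Qed.

(** By invariance of the form, the bracket of two root vectors in duality represents [alpha]. *)
Lemma root_represented alpha : roots E alpha -> represented alpha.
Proof.
move=> [u au u0]; have [v av uv] := root_space_dual au u0.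
have := root_space_lie au av; rewrite subrr root_space0E => -[k _ uvk].
apply: proj2 (t_unique (k := k) _) => h.
by rewrite uvk -form_lie au linearZl_LR /= uv mulr1.
Qed.

Lemma roots_opp alpha : roots E alpha -> roots E (- alpha).
Proof.
move=> [u au u0]; have [v av uv] := root_space_dual au u0.
by exists v => //; apply: contra_eq_neq uv => ->; rewrite linear0r eq_sym oner_eq0.
Qed.

Lemma represented0 : represented 0 /\ t_ (0 : dual_cartan E) = 0.
Proof.
have [] // := @t_unique 0 0 => h; rewrite dual_zeroE linear0.
by rewrite linear0r.
Qed.

Lemma t_opp alpha : represented alpha -> t_ (- alpha) = - t_ alpha.
Proof.
have [r0 t0] := represented0.
by move=> ra; have [] := t_lin (- 1) ra r0; rewrite !scaleN1r !addr0 t0 addr0.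
Qed.

Lemma represented_add alpha beta : represented alpha -> represented beta ->
  represented (alpha + beta).
Proof. by move=> ra rb; have [_] := t_lin 1 ra rb; rewrite scale1r. Qed.

Lemma represented_opp alpha : represented alpha -> represented (- alpha).
Proof.
have [r0 t0] := represented0.
by move=> ra; have [_] := t_lin (- 1) ra r0; rewrite scaleN1r addr0.
Qed.

Lemma represented_mulz alpha (m : int) : represented alpha -> represented (alpha *~ m).
Proof.
have [r0 t0] := represented0.
by move=> ra; have [_] := t_lin m%:~R ra r0; rewrite addr0 scaler_int.
Qed.

Lemma dual_formE alpha beta : represented alpha -> dual_form alpha beta = alpha (t_ beta).
Proof. by move=> ra; rewrite /dual_form formC -ra. Qed.

Lemma dual_formC alpha beta : dual_form alpha beta = dual_form beta alpha :> R[i].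
Proof. by rewrite /dual_form formC. Qed.

Lemma dual_formDl alpha beta sigma : represented alpha -> represented beta ->
  dual_form (alpha + beta) sigma = dual_form alpha sigma + dual_form beta sigma.
Proof.
by move=> ra rb; rewrite !dual_formE ?dual_addE //; exact: represented_add.
Qed.

Lemma dual_formNl alpha sigma : represented alpha ->
  dual_form (- alpha) sigma = - dual_form alpha sigma.
Proof.
by move=> ra; rewrite !dual_formE ?dual_oppE //; exact: represented_opp.
Qed.

Lemma dual_formMzl alpha (m : int) sigma : represented alpha ->
  dual_form (alpha *~ m) sigma = m%:~R * dual_form alpha sigma.
Proof.
by move=> ra; rewrite !dual_formE ?dual_mulzE //; exact: represented_mulz.
Qed.

Lemma dual_form_addMz alpha beta (m : int) : represented alpha -> represented beta ->
  dual_form (beta + alpha *~ m) (beta + alpha *~ m) =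
  dual_form beta beta + 2 * m%:~R * dual_form beta alpha + m%:~R ^+ 2 * dual_form alpha alpha.
Proof.
move=> ra rb; have rm := represented_mulz m ra.
have D s : dual_form (beta + alpha *~ m) s = dual_form beta s + m%:~R * dual_form alpha s.
  by rewrite dual_formDl // dual_formMzl.
by rewrite D (dual_formC beta) (dual_formC alpha) !D (dual_formC alpha beta); ring.
Qed.

Lemma h_pairing alpha beta : represented beta ->
  beta (h_ alpha) = 2 / dual_form alpha alpha * dual_form beta alpha.
Proof. by move=> rb; rewrite /h_ linearZ /= (dual_formE _ rb). Qed.

Definition Rx := nonisotropic_roots E.

Lemma RxP alpha : Rx alpha <-> roots E alpha /\ dual_form alpha alpha != 0.
Proof.
split=> [[ra nra]|[ra na]]; split=> //; first by apply/eqP => na; apply: nra.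
by case=> _ /= na0; rewrite na0 eqxx in na.
Qed.

Lemma Rx_root alpha : Rx alpha -> roots E alpha. Proof. by case. Qed.
Lemma Rx_represented alpha : Rx alpha -> represented alpha.
Proof. by move=> /Rx_root/root_represented. Qed.
Lemma Rx_neq0 alpha : Rx alpha -> dual_form alpha alpha != 0.
Proof. by case/RxP. Qed.
Lemma iso_root sigma : isotropic_roots E sigma -> roots E sigma. Proof. by case. Qed.
Lemma iso_represented sigma : isotropic_roots E sigma -> represented sigma.
Proof. by move=> /iso_root/root_represented. Qed.
Lemma iso_form sigma : isotropic_roots E sigma -> dual_form sigma sigma = 0.
Proof. by case. Qed.
Lemma root_cases alpha : roots E alpha -> isotropic_roots E alpha \/ Rx alpha.
Proof.
move=> ra; case: (eqVneq (dual_form alpha alpha) 0) => a0; first by left.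
by right; apply/RxP.
Qed.
Lemma Rx_not_iso alpha : Rx alpha -> ~ isotropic_roots E alpha.
Proof. by move=> /RxP[_ /eqP a0] [_ /a0]. Qed.

Lemma iso_opp sigma : isotropic_roots E sigma -> isotropic_roots E (- sigma).
Proof.
move=> s0; have rs := iso_represented s0; split; first exact/roots_opp/iso_root.
by rewrite /= dual_formNl // dual_formC dual_formNl // iso_form // !oppr0.
Qed.

Lemma Rx_opp alpha : Rx alpha -> Rx (- alpha).
Proof.
move=> Ra; have ra := Rx_represented Ra.
apply/RxP; split; first exact/roots_opp/Rx_root.
by rewrite dual_formNl // dual_formC dual_formNl // opprK Rx_neq0.
Qed.

Lemma h_opp alpha : represented alpha -> h_ (- alpha) = - h_ alpha.
Proof.
move=> ra; rewrite /h_ t_opp // dual_formNl // dual_formC dual_formNl // opprK.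
by rewrite scalerN.
Qed.

Lemma h_self alpha : Rx alpha -> alpha (h_ alpha) = 2.
Proof.
by move=> Ra; rewrite h_pairing ?mulfVK ?Rx_neq0 //; exact: Rx_represented.
Qed.

End RootSpaces.

(** * Root strings, and orthogonality of isotropic roots to the others *)

Section RootStrings.
Context {R : realType} (E : eala R) (tau : E -> E) (x : dual_cartan E -> E).
Implicit Types (alpha beta sigma : dual_cartan E) (h : cartan E) (u v w : E).
Hypothesis cs : chevalley_system tau x.

Lemma chev_root alpha : Rx alpha -> root_space alpha (x alpha).
Proof. by case/cs. Qed.
Lemma chev_opp alpha : Rx alpha -> root_space (- alpha) (x (- alpha)).
Proof. by move=> /Rx_opp/chev_root. Qed.

Lemma chev_sl2 alpha : Rx alpha -> sl2_triple (x alpha) (x (- alpha)) (incl E (h_ alpha)).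
Proof.
move=> Ra; split; first by case: (cs Ra).
  by rewrite (chev_root Ra) h_self.
by rewrite (chev_opp Ra) dual_oppE h_self.
Qed.

Lemma chev_nilpotent alpha : Rx alpha -> ad_nilpotent (x alpha).
Proof. by move=> Ra y; exact: (ad_locally_nilpotent (ealaP E) Ra (chev_root Ra)). Qed.

Lemma chev_neq0 alpha : Rx alpha -> x alpha != 0.
Proof.
move=> Ra; apply/eqP => x0; case: (chev_sl2 Ra) => ef _ _.
have /esym/eqP := ef; rewrite x0 lie0l incl_eq0 => /eqP h0.
by have := h_self Ra; rewrite h0 linear0 => /esym/eqP; rewrite pnatr_eq0.
Qed.

Lemma chev_form alpha : Rx alpha ->
  form E (x alpha) (x (- alpha)) = 2 / dual_form alpha alpha.
Proof.
move=> Ra; have ra := Rx_represented Ra; case: (chev_sl2 Ra) => ef _ _.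
have := root_space_lie_opp ra (chev_root Ra) (chev_opp Ra).
rewrite ef /h_ linearZ /= => /eqP; rewrite -subr_eq0 -scalerBl scaler_eq0 incl_eq0.
case/orP => [|/eqP t0]; first by rewrite subr_eq0 => /eqP ->.
by have := Rx_neq0 Ra; rewrite dual_formE // t0 linear0 eqxx.
Qed.

(* A vector of [E_alpha] orthogonal to [x_(-alpha)] would be a lowest weight
   vector of positive weight. *)
Lemma root_space_dim1 alpha u : Rx alpha -> root_space alpha u ->
  exists c : R[i], u = c *: x alpha.
Proof.
move=> Ra au; have ra := Rx_represented Ra.
pose c := form E u (x (- alpha)) / form E (x alpha) (x (- alpha)).
have f0 : form E (x alpha) (x (- alpha)) != 0.
  by rewrite chev_form // mulf_neq0 ?invr_neq0 ?Rx_neq0 // pnatr_eq0.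
exists c; apply/eqP; rewrite -subr_eq0; apply/eqP.
have av : root_space alpha (u - c *: x alpha).
  by apply: root_spaceD au _; apply/root_spaceN/root_spaceZ/chev_root.
apply: (sl2_highest_weight_ge0 (p := - 2) (sl2_tripleC (chev_sl2 Ra)) (chev_nilpotent Ra)).
- rewrite lieC (root_space_lie_opp ra av (chev_opp Ra)) linearBl /= linearZl_LR /=.
  by rewrite divfK // subrr scale0r oppr0.
- by rewrite lieNl av h_self // scaleNr.
- by rewrite oppr_lt0 ltr0n.
Qed.

Lemma string_above alpha beta : Rx alpha -> roots E beta ->
  exists q n, beta (h_ alpha) = n%:R - (q%:R + q%:R) /\
    forall k, (k <= n)%N -> roots E (beta + alpha *~ (q%:Z - k%:Z)).
Proof.
move=> Ra [v bv v0]; have ax := chev_root Ra.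
have [q [q0 q1]] := last_nonzero_iter v0 (chev_nilpotent Ra v).
set w := iter q _ v in q0.
have bw : root_space (beta + alpha *+ q) w by exact: root_space_iter.
have [n pn fn] := sl2_highest_weight (chev_sl2 Ra) (chev_nilpotent (Rx_opp Ra)) q0 q1 (bw _).
exists q, n; split.
  rewrite -pn dual_addE pmulrn dual_mulzE h_self // -pmulrn.
  by rewrite mulr_natr mulr2n addrK.
move=> k kn; have := root_space_iter k (chev_opp Ra) bw.
rewrite -addrA mulNrn !pmulrn -mulrzBr => /root_space_root; apply; exact: fn.
Qed.

(** For a non-negative pairing, lowering from the top of the string passes through everything
    between [beta] and its reflection; for a negative one the same is done with [- alpha]. *)
Lemma root_string alpha beta : Rx alpha -> roots E beta ->
  exists2 p : int, beta (h_ alpha) = p%:~R &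
    forall k : int, (0 <= k <= - p) || (- p <= k <= 0) -> roots E (beta + alpha *~ k).
Proof.
move=> Ra rb; have ra := Rx_represented Ra.
have [q [n [pE strE]]] := string_above Ra rb.
have [q' [n' [pE' strE']]] := string_above (Rx_opp Ra) rb.
have pZ : beta (h_ alpha) = (n%:Z - (q%:Z + q%:Z))%:~R by rewrite pE rmorphB rmorphD.
exists (n%:Z - (q%:Z + q%:Z)) => // k.
have pn' : n'%:Z - (q'%:Z + q'%:Z) = - (n%:Z - (q%:Z + q%:Z)).
  apply: (@intr_inj R[i]); rewrite rmorphN /= -pZ rmorphB rmorphD /= -pE'.
  by rewrite h_opp // linearN.
move=> kp; case: (leP 0 (n%:Z - (q%:Z + q%:Z))) => p0.
  have := strE (absz (q%:Z - k)); have -> : q%:Z - (absz (q%:Z - k))%:Z = k by lia.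
  by apply; lia.
have := strE' (absz (q'%:Z + k)); have -> : q'%:Z - (absz (q'%:Z + k))%:Z = - k by lia.
by rewrite mulrNz mulNrz opprK; apply; lia.
Qed.

(** Otherwise some string in an isotropic direction is infinite, and the pairings along it cannot
    all be integers. *)
Lemma isotropic_orthogonal alpha sigma : Rx alpha -> isotropic_roots E sigma ->
  dual_form alpha sigma = 0.
Proof.
move=> Ra s0; apply/eqP; apply: contraPT isT => as0 _.
have ra := Rx_represented Ra; have rs := iso_represented s0.
(* [E_sigma] and [E_(-sigma)] generate a Heisenberg algebra whose centre acts
   on the string [alpha + Z sigma] by a non-zero scalar, so the string is
   infinite in at least one direction. *)
have [sg [al [rsg ral isg asg ladder]]] : exists sg al, [/\ roots E sg, represented al,
    dual_form sg sg = 0, dual_form al sg != 0 & forall j, roots E (al + sg *+ j)].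
  have [y sy y0] := iso_root s0; have [z sz yz1] := root_space_dual sy y0.
  have yz : lie y z = incl E (t_ sigma) by rewrite (root_space_lie_opp rs sy sz) yz1 scale1r.
  have [v av v0] := Rx_root Ra.
  case: (pselect (exists n, iter n (lie y) v = 0)) => [yv|ynv]; last first.
    exists sigma, alpha; split=> //; [exact: iso_root|exact: iso_form|move=> j].
    exists (iter j (lie y) v); first exact: root_space_iter.
    by apply/eqP => vj; apply: ynv; exists j.
  have [n [n0 n1]] := last_nonzero_iter v0 yv.
  set w := iter n _ v in n0.
  have aw : root_space (alpha + sigma *+ n) w by exact: root_space_iter.
  have st : dual_form sigma sigma = 0 by exact: iso_form.
  have rn := represented_mulz n%:Z rs.
  have wt j : (alpha + sigma *+ n + (- sigma) *+ j) (t_ sigma) = dual_form alpha sigma.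
    rewrite mulNrn !pmulrn -addrA -mulrzBr dual_addE dual_mulzE -!dual_formE //.
    by rewrite st mulr0 addr0.
  exists (- sigma), (alpha + sigma *+ n); split.
  - exact/roots_opp/iso_root.
  - by apply: represented_add; rewrite // pmulrn.
  - by rewrite dual_formNl // dual_formC dual_formNl // st !oppr0.
  - rewrite dual_formC dual_formNl // oppr_eq0 pmulrn dual_formC dual_formDl // dual_formMzl //.
    by rewrite st mulr0 addr0.
  move=> j; exists (iter j (lie z) w); first exact: root_space_iter.
  have hw k : lie (incl E (t_ sigma)) (iter k (lie z) w) = dual_form alpha sigma *: iter k (lie z) w.
    by rewrite (root_space_iter k sz aw) wt.
  have yzw : lie y (lie z w) = dual_form alpha sigma *: w.
    have yw : lie y w = 0 by exact: n1.
    by rewrite lie_leibniz yz (hw 0%N) yw linear0 addr0.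
  (* Applying [y] to the lowered vector number j + 1 gives (j + 1) (alpha, sigma) times the one
     before it, and this scalar is non-zero. *)
  elim: j => // j IH; apply/eqP => j0.
  have := lie_iter_step yz yzw hw j; rewrite j0 linear0 => /esym/eqP.
  rewrite scaler_eq0 (negPf IH) orbF big_const_nat iter_addr_0 subSS subn0 -mulrS.
  by rewrite mulrn_eq0 (negPf as0).
have norm j : dual_form (al + sg *+ j) (al + sg *+ j) =
    dual_form al al + 2 * j%:R * dual_form al sg.
  by rewrite pmulrn dual_form_addMz ?isg ?mulr0 ?addr0 //; exact: root_represented.
have sgE j : dual_form sg (al + sg *+ j) = dual_form al sg.
  rewrite dual_formC pmulrn dual_formDl ?dual_formMzl ?isg ?mulr0 ?addr0 //.
    exact: root_represented.
  exact/represented_mulz/root_represented.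
have integral j : Rx (al + sg *+ j) -> exists2 m : int, m != 0 &
    m%:~R * (dual_form al al + 2 * j%:R * dual_form al sg) = 2 * dual_form al sg.
  move=> Rj; have [m mE _] := root_string Rj rsg; exists m.
    apply/eqP => m0; move: mE; rewrite m0 h_pairing; last exact: root_represented.
    move/eqP; rewrite mulf_eq0 mulf_eq0 pnatr_eq0 invr_eq0 (negPf (Rx_neq0 Rj)) /=.
    by rewrite sgE (negPf asg).
  rewrite -norm -mE h_pairing; last exact: root_represented.
  by rewrite mulrAC divfK ?Rx_neq0 // sgE.
(* The norm is affine in j with non-zero slope, so of two consecutive members at most one is
   isotropic. *)
have Rj j : exists j', [/\ (j <= j')%N, (j' <= j.+1)%N & Rx (al + sg *+ j')].
  case: (eqVneq (dual_form (al + sg *+ j) (al + sg *+ j)) 0) => [j0|j0]; last first.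
    by exists j; split=> //; apply/RxP.
  exists j.+1; split=> //; apply/RxP; split=> //; rewrite norm.
  have -> : dual_form al al + 2 * j.+1%:R * dual_form al sg = 2 * dual_form al sg.
    by rewrite -[RHS]add0r -j0 norm -[j.+1]addn1 natrD; ring.
  by rewrite mulf_neq0 ?pnatr_eq0.
have [j [_ j1 /integral[m m0 mE]]] := Rj 0%N.
have [j' [j4 _ /integral[m' m0' mE']]] := Rj 4%N.
(* Equivalently 1/m' - 1/m = j' - j. The starting points 0 and 4 make this at least 3, whereas
   reciprocals of non-zero integers differ by at most 2. *)
have : m * m' * (j'%:Z - j%:Z) = m - m'.
  apply: (@intr_inj R[i]); rewrite !(rmorphM, rmorphB) /=.
  have c0 : 2 * dual_form al sg != 0 by rewrite mulf_neq0 ?pnatr_eq0.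
  apply: (mulIf c0); rewrite -!pmulrn.
  transitivity (m%:~R * (m'%:~R * (dual_form al al + 2 * j'%:R * dual_form al sg)) -
      m'%:~R * (m%:~R * (dual_form al al + 2 * j%:R * dual_form al sg))); first ring.
  by rewrite mE mE' mulrBl.
have : 3 <= j'%:Z - j%:Z by lia.
move: (j'%:Z - j%:Z) => d d3 md.
have {md} : m' * (m * d + 1) = m by rewrite mulrDr mulr1 mulrA (mulrC m') md subrK.
have [m_gt0|m_le0] := ltP 0 m; have [m'_gt0|m'_le0] := ltP 0 m'.
- by have : m * 3 <= m * d; nia.
- by have : m * 3 <= m * d; nia.
- by have : m * d <= m * 3; nia.
- by have : m * d <= m * 3; nia.
Qed.

End RootStrings.

(** * Cartan integers, root reflections and bounds on the pairings *)

Section Pairings.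
Context {R : realType} (E : eala R) (tau : E -> E) (x : dual_cartan E -> E).
Implicit Types (alpha beta gamma sigma : dual_cartan E) (p q s k m : int).
Hypothesis cs : chevalley_system tau x.

(** The Cartan integer; by [pairingE] it has its meaning whenever [beta] is a root and [alpha] a
    non-isotropic one. *)
Definition pairing beta alpha : int := xget 0 [set p : int | beta (h_ alpha) = p%:~R].

Lemma pairingE alpha beta : Rx alpha -> roots E beta ->
  beta (h_ alpha) = (pairing beta alpha)%:~R.
Proof.
move=> Ra rb; rewrite /pairing; case: xgetP => [//|n].
by have [p pE _] := root_string cs Ra rb; case: (n p).
Qed.

Lemma pairing_unique alpha beta p : Rx alpha -> roots E beta ->
  beta (h_ alpha) = p%:~R -> pairing beta alpha = p.
Proof. by move=> Ra rb; rewrite pairingE // => /intr_inj. Qed.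

Lemma pairing_string alpha beta k : Rx alpha -> roots E beta ->
  (0 <= k <= - pairing beta alpha) || (- pairing beta alpha <= k <= 0) ->
  roots E (beta + alpha *~ k).
Proof.
move=> Ra rb kp; have [p pE] := root_string cs Ra rb; apply.
by rewrite -(pairing_unique Ra rb pE).
Qed.

Lemma pairing_form alpha beta : Rx alpha -> roots E beta ->
  (pairing beta alpha)%:~R * dual_form alpha alpha = 2 * dual_form beta alpha.
Proof.
move=> Ra rb; rewrite -pairingE // h_pairing; last exact: root_represented.
by rewrite mulrAC divfK // Rx_neq0.
Qed.

Lemma pairing_self alpha : Rx alpha -> pairing alpha alpha = 2.
Proof. by move=> Ra; apply: pairing_unique => //; [exact: Rx_root|exact: h_self]. Qed.

Lemma pairing_addMz alpha beta gamma k : Rx gamma -> roots E alpha -> roots E beta ->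
  roots E (beta + alpha *~ k) ->
  pairing (beta + alpha *~ k) gamma = pairing beta gamma + k * pairing alpha gamma.
Proof.
move=> Rg ra rb rk; apply: pairing_unique => //.
by rewrite dual_addE dual_mulzE !pairingE // rmorphD rmorphM.
Qed.

Lemma pairing_opp alpha beta : Rx alpha -> roots E beta ->
  pairing (- beta) alpha = - pairing beta alpha.
Proof.
move=> Ra rb; apply: pairing_unique => //; first exact: roots_opp.
by rewrite dual_oppE pairingE // rmorphN.
Qed.

Lemma isotropic_h alpha sigma : Rx alpha -> isotropic_roots E sigma -> sigma (h_ alpha) = 0.
Proof.
move=> Ra s0; rewrite h_pairing; last exact: iso_represented.
by rewrite dual_formC (isotropic_orthogonal cs Ra s0) mulr0.
Qed.

Lemma Rx_of_pairing alpha gamma : Rx alpha -> roots E gamma ->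
  pairing gamma alpha != 0 -> Rx gamma.
Proof.
move=> Ra rg; case: (root_cases rg) => // g0 /eqP[]; apply: pairing_unique => //.
exact: isotropic_h.
Qed.

Lemma pairing_eq0 alpha beta : Rx alpha -> Rx beta ->
  pairing beta alpha = 0 -> pairing alpha beta = 0.
Proof.
move=> Ra Rb p0; have := pairing_form Ra (Rx_root Rb); rewrite p0 mul0r dual_formC.
rewrite -pairing_form //; last exact: Rx_root.
by move/esym/eqP; rewrite mulf_eq0 (negPf (Rx_neq0 Rb)) orbF intr_eq0 => /eqP.
Qed.

Definition root_reflection beta alpha := alpha - beta *~ pairing alpha beta.

Lemma root_reflection_root alpha beta : Rx beta -> roots E alpha ->
  roots E (root_reflection beta alpha).
Proof.
move=> Rb ra; rewrite /root_reflection -mulrNz; apply: pairing_string => //.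
by case: (leP 0 (pairing alpha beta)) => ?; lia.
Qed.

Lemma root_reflection_form alpha beta : Rx beta -> roots E alpha ->
  dual_form (root_reflection beta alpha) (root_reflection beta alpha) = dual_form alpha alpha.
Proof.
move=> Rb ra; rewrite /root_reflection -mulrNz dual_form_addMz //;
  [|exact: Rx_represented|exact: root_represented].
by have := pairing_form Rb ra; rewrite rmorphN /= => pf; ring: pf.
Qed.

Lemma root_reflection_Rx alpha beta : Rx beta -> Rx alpha -> Rx (root_reflection beta alpha).
Proof.
move=> Rb Ra; have ra := Rx_root Ra; apply/RxP; split; first exact: root_reflection_root.
by rewrite root_reflection_form // Rx_neq0.
Qed.

Lemma pairing_reflection alpha beta : Rx beta -> roots E alpha ->
  pairing (root_reflection beta alpha) beta = - pairing alpha beta.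
Proof.
move=> Rb ra; have := root_reflection_root Rb ra; rewrite /root_reflection -mulrNz => rr.
by rewrite pairing_addMz // ?pairing_self //; [lia|exact: Rx_root].
Qed.

Lemma root_reflectionK alpha beta : Rx beta -> roots E alpha ->
  root_reflection beta (root_reflection beta alpha) = alpha.
Proof.
by move=> Rb ra; rewrite {1}/root_reflection pairing_reflection // mulrNz opprK subrK.
Qed.

Lemma root_reflection_add alpha beta sigma : Rx beta -> roots E alpha ->
  isotropic_roots E sigma -> roots E (alpha + sigma) ->
  root_reflection beta (alpha + sigma) = root_reflection beta alpha + sigma.
Proof.
move=> Rb ra s0 rs; rewrite /root_reflection.
rewrite (@pairing_unique beta (alpha + sigma) (pairing alpha beta)) //; first by rewrite addrAC.
by rewrite dual_addE (isotropic_h Rb s0) addr0 pairingE.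
Qed.

Lemma Rx_shift alpha sigma : Rx alpha -> isotropic_roots E sigma ->
  dual_form (alpha + sigma) (alpha + sigma) = dual_form alpha alpha.
Proof.
move=> Ra s0; have := @dual_form_addMz _ E sigma alpha 1 (iso_represented s0) (Rx_represented Ra).
by rewrite mulr1z (isotropic_orthogonal cs Ra s0) (iso_form s0) !mulr0 !addr0.
Qed.

Lemma Rx_shiftP alpha sigma : Rx alpha -> isotropic_roots E sigma ->
  roots E (alpha + sigma) -> Rx (alpha + sigma).
Proof. by move=> Ra s0 r; apply/RxP; rewrite Rx_shift // Rx_neq0. Qed.

(* With [gamma = beta + k alpha], this is [pairing_form] for [alpha] against
   [gamma] after all the norms have been expressed through that of [alpha]. *)
Lemma pairing_string_eq alpha beta k : Rx alpha -> Rx beta -> Rx (beta + alpha *~ k) ->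
  pairing alpha (beta + alpha *~ k) *
    (pairing beta alpha + pairing alpha beta * (k * (pairing beta alpha + k))) =
  (pairing beta alpha + 2 * k) * pairing alpha beta.
Proof.
move=> Ra Rb Rg; have [ra rb rg] := And3 (Rx_root Ra) (Rx_root Rb) (Rx_root Rg).
have pA := pairing_form Ra rb; have sB := pairing_form Rb ra; have mG := pairing_form Rg ra.
apply: (@intr_inj R[i]); apply: (mulIf (Rx_neq0 Ra)).
have [Ta Tb] := (Rx_represented Ra, Rx_represented Rb).
rewrite dual_form_addMz // (dual_formC alpha) dual_formDl ?dual_formMzl // in mG; last exact: represented_mulz.
rewrite (dual_formC alpha) in sB.
rewrite !(rmorphM, rmorphD) /=.
move: (pairing _ _)%:~R (pairing beta alpha)%:~R (pairing alpha beta)%:~R k%:~R pA sB mG => m p s k'.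
move: (dual_form alpha alpha) (dual_form beta beta) (dual_form beta alpha) => A B C pA sB mG.
transitivity (s * (m * (B + 2 * k' * C + k' ^+ 2 * A))); last by rewrite mG; ring: pA.
by ring: pA sB.
Qed.

(** Let p and s be the two pairings. Near the middle of the string, at k = -j with p - 2 j equal to
    c = 1 or 2, [pairing_string_eq] reads m (p - s j (p - j)) = c s. If p >= 7 then j >= 3, and the
    left side is too large in absolute value for non-zero integers m and s. *)
Lemma pairing_le6 alpha beta : Rx alpha -> Rx beta -> pairing beta alpha <= 6.
Proof.
move=> Ra Rb; rewrite leNgt; apply/negP => p7.
have s0 : pairing alpha beta != 0.
  by apply/eqP => /(pairing_eq0 Rb Ra) p0; rewrite p0 in p7.
(* A non-zero pairing with [alpha] shows that a member of the string is not isotropic. *)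
have key k : - pairing beta alpha <= k <= 0 -> pairing beta alpha + 2 * k != 0 ->
    Rx (beta + alpha *~ k).
  move=> kp u0; have rk : roots E (beta + alpha *~ k).
    by apply: pairing_string => //; [exact: Rx_root|rewrite kp orbT].
  apply: (Rx_of_pairing Ra rk).
  by rewrite pairing_addMz ?pairing_self ?(mulrC k) //; exact: Rx_root.
have [j [j3 pj]] : exists j : int, 3 <= j /\
   (pairing beta alpha = 2 * j + 1 \/ pairing beta alpha = 2 * j + 2).
  by exists ((pairing beta alpha - 1) %/ 2)%Z; lia.
have Rj : Rx (beta + alpha *~ (- j)) by apply: key; lia.
have := pairing_string_eq Ra Rb Rj; move: (pairing alpha _) => m.
move: (pairing alpha beta) (pairing beta alpha) s0 pj {p7 key} => s p s0 pj eqm.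
have {eqm} [c [c0 c2 eqm]] : exists c, [/\ 0 < c, c <= 2 & m * (p - s * (j * (p - j))) = c * s].
  by case: pj => pj; [exists 1|exists 2]; split=> //; move: eqm; rewrite pj; lia.
have : j * (p - j) - 2 > p by case: pj => ->; nia.
have : p > 0 by lia.
move: (j * (p - j)) eqm => J eqm p0 Jp.
have m0 : m != 0 by apply/eqP => m0; move: eqm; rewrite m0 mul0r; nia.
have [s1|s1] : s >= 1 \/ s <= - 1 by lia.
  have : s * (J - 2) >= J - 2 by nia.
  have [m1|m1] : m >= 1 \/ m <= - 1 by lia.
    by move=> sJ; have : m * (s * J - p) >= s * J - p; nia.
  by move=> sJ; have : (- m) * (s * J - p) >= s * J - p; nia.
have : (- s) * (J - 2) >= J - 2 by nia.
have [m1|m1] : m >= 1 \/ m <= - 1 by lia.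
  by move=> sJ; have : m * (p - s * J) >= p - s * J; nia.
by move=> sJ; have : (- m) * (p - s * J) >= p - s * J; nia.
Qed.

Lemma pairing_bound alpha beta : Rx alpha -> Rx beta -> `|pairing beta alpha| <= 6.
Proof.
move=> Ra Rb; rewrite ler_norml pairing_le6 // andbT.
have := pairing_le6 Ra (Rx_opp Rb); rewrite pairing_opp //; last exact: Rx_root.
by rewrite lerNl.
Qed.

(* Reflecting twice turns the product [P] of the two pairings into [2 - P] and
   then [2 - (2 - P)^2], which is bounded only if [0 <= P <= 4]. *)
Lemma pairing_mul_bound alpha beta : Rx alpha -> Rx beta ->
  0 <= pairing beta alpha * pairing alpha beta <= 4.
Proof.
move=> Ra Rb; have ra := Rx_root Ra.
have step gamma : Rx gamma -> pairing (root_reflection gamma alpha) alpha =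
    2 - pairing alpha gamma * pairing gamma alpha.
  move=> Rg; have := root_reflection_root Rg ra; rewrite /root_reflection -mulrNz => rr.
  by rewrite pairing_addMz ?pairing_self ?mulNr //; exact: Rx_root.
pose b1 := root_reflection beta alpha; have Rb1 : Rx b1 by exact: root_reflection_Rx.
(* [alpha] and its reflection have the same norm, so their two pairings agree. *)
have b1sym : pairing alpha b1 = pairing b1 alpha.
  apply: (@intr_inj R[i]); apply: (mulIf (Rx_neq0 Ra)).
  rewrite pairing_form //; last exact: Rx_root.
  by rewrite dual_formC -pairing_form // root_reflection_form.
(* The bound 6 on 2 - (2 - P)^2 gives (2 - P)^2 <= 8, hence |2 - P| <= 2. *)
have := pairing_bound Ra (root_reflection_Rx Rb1 Ra).
rewrite step // b1sym /b1 step // (mulrC (pairing alpha beta)).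
by move: (_ * pairing alpha beta) => P; nia.
Qed.

End Pairings.

(** * Structure constants of a Chevalley system *)

Section StructureConstants.
Context {R : realType} (E : eala R) (tau : E -> E) (x : dual_cartan E -> E).
Implicit Types (alpha beta gamma sigma : dual_cartan E).
Hypothesis ci : chevalley_involution tau.
Hypothesis cs : chevalley_system tau x.
Hypothesis no_double : forall alpha beta, Rx alpha -> Rx beta ->
  ~ isotropic_roots E (beta - alpha *~ 2).

Lemma core_subalgebra : lie_subalgebra (core E).
Proof.
split; first split.
- by apply/mem_set => S [[[S0 _] _] _]; apply: set_mem; exact: S0.
- move=> c u v /set_mem cu /set_mem cv; apply/mem_set => S SP.
  have [[[_ Slin] _] _] := SP; apply: set_mem; apply: Slin; apply/mem_set.
    exact: cu.
  exact: cv.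
- move=> u v cu cv S SP; have [[_ Slie] _] := SP.
  by apply: Slie; [exact: cu|exact: cv].
Qed.

Lemma core0 : core E 0.
Proof. by have [[c0 _] _] := core_subalgebra; apply: set_mem. Qed.

Lemma core_lin (c : R[i]) u v : core E u -> core E v -> core E (c *: u + v).
Proof.
have [[_ cl] _] := core_subalgebra.
by move=> cu cv; apply/set_mem/cl; exact: mem_set.
Qed.

Lemma core_lie u v : core E u -> core E v -> core E (lie u v).
Proof. by case: core_subalgebra => _; exact. Qed.

Lemma coreD u v : core E u -> core E v -> core E (u + v).
Proof. by move=> cu; rewrite -[u]scale1r; exact: core_lin. Qed.

Lemma coreN u : core E u -> core E (- u).
Proof. by move=> cu; rewrite -[- u]addr0 -scaleN1r; apply: core_lin => //; exact: core0. Qed.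

Lemma core_root_space alpha u : Rx alpha -> root_space alpha u -> core E u.
Proof. by move=> Ra au S [_ sub]; apply: sub; exists alpha. Qed.

Lemma core_chev alpha : Rx alpha -> core E (x alpha).
Proof. by move=> Ra; exact: (core_root_space Ra (chev_root cs Ra)). Qed.

Lemma tau_lin (c : R[i]) u v : core E u -> core E v -> tau (c *: u + v) = c *: tau u + tau v.
Proof. by case: ci => -[_ + _] _ _; exact. Qed.

Lemma tau_lie u v : core E u -> core E v -> tau (lie u v) = lie (tau u) (tau v).
Proof. by case: ci => -[_ _ +] _ _; exact. Qed.

Lemma tau0 : tau 0 = 0.
Proof.
by have := tau_lin (- 1) core0 core0; rewrite scaler0 addr0 scaleN1r addNr.
Qed.

Lemma tauZ (c : R[i]) u : core E u -> tau (c *: u) = c *: tau u.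
Proof. by move=> cu; rewrite -[c *: u]addr0 tau_lin // ?tau0 ?addr0 //; exact: core0. Qed.

Lemma tauD u v : core E u -> core E v -> tau (u + v) = tau u + tau v.
Proof. by move=> cu cv; rewrite -[u]scale1r tau_lin // !scale1r. Qed.

Lemma tauN u : core E u -> tau (- u) = - tau u.
Proof. by move=> cu; rewrite -scaleN1r tauZ // scaleN1r. Qed.

Lemma tau_inj u v : core E u -> core E v -> tau u = tau v -> u = v.
Proof. by case: ci => -[[_ + _] _ _] _ _ => ti cu cv; apply: ti; exact: mem_set. Qed.

Lemma tau_chev alpha : Rx alpha -> tau (x alpha) = - x (- alpha).
Proof. by case/cs. Qed.

(** The other pairing would be 1, and the norms would make [beta - alpha *~ 2] an isotropic root:
    the excluded BC pattern. *)
Lemma pairing_neq4 alpha beta : Rx alpha -> Rx beta -> pairing beta alpha <> 4.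
Proof.
move=> Ra Rb p4; have [ra rb] := (Rx_root Ra, Rx_root Rb).
have s1 : pairing alpha beta = 1.
  have s0 : pairing alpha beta <> 0 by move=> /(pairing_eq0 cs Rb Ra); rewrite p4.
  by have := pairing_mul_bound cs Ra Rb; rewrite p4; lia.
apply: (no_double Ra Rb).
have pA := pairing_form cs Ra rb; have sB := pairing_form cs Rb ra.
rewrite p4 s1 (dual_formC alpha) in pA sB.
split; first by rewrite -mulrNz; apply: (pairing_string cs) => //; rewrite p4.
rewrite /= -mulrNz (dual_form_addMz _ (Rx_represented Ra) (Rx_represented Rb)).
by move: pA sB; rewrite rmorphN /= => pA sB; ring: pA sB.
Qed.

(** Applying [tau] gives the constant [- N] for the opposite roots; invariance of the form, with the
    values from [chev_form], relates it to [N']. *)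
Lemma chev_norm alpha beta (N : R[i]) : Rx alpha -> Rx beta -> Rx (alpha + beta) ->
  lie (x alpha) (x beta) = N *: x (alpha + beta) ->
  exists N' : R[i], lie (x (- alpha)) (x (alpha + beta)) = N' *: x beta /\
    N' * dual_form (alpha + beta) (alpha + beta) = N * dual_form beta beta.
Proof.
move=> Ra Rb Rab eN.
have bf : root_space beta (lie (x (- alpha)) (x (alpha + beta))).
  have := root_space_lie (chev_opp cs Ra) (chev_root cs Rab).
  by rewrite addKr.
have [N' eN'] := root_space_dim1 cs Rb bf; exists N'; split=> //.
have eNN : lie (x (- alpha)) (x (- beta)) = - N *: x (- (alpha + beta)).
  have := congr1 tau eN.
  have [cA cB cAB] := And3 (core_chev Ra) (core_chev Rb) (core_chev Rab).
  rewrite tau_lie // tauZ // !tau_chev //.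
  by rewrite lieNl [lie _ (- _)]linearN opprK /= scalerN scaleNr.
have : N' * (2 / dual_form beta beta) =
    N * (2 / dual_form (alpha + beta) (alpha + beta)).
  rewrite -!(chev_form cs) // -linearZl_LR /= -eN' form_lie formC form_lie.
  by rewrite (lieC (x (- beta))) eNN scaleNr opprK linearZr_LR.
have := Rx_neq0 Rb; have := Rx_neq0 Rab.
move: (dual_form beta beta) (dual_form (alpha + beta) _) => B D D0 B0 e.
have two0 : 2 != 0 :> R[i] by rewrite pnatr_eq0.
transitivity (N' * (2 / B) * (B * D / 2)); first by field; rewrite B0.
by rewrite e; field; rewrite D0.
Qed.

Lemma intr_of_sqr (N : R[i]) (n : int) : N ^+ 2 = n%:~R ^+ 2 -> exists m : int, N = m%:~R.
Proof.
move/eqP; rewrite eqf_sqr => /orP[/eqP ->|/eqP ->]; first by exists n.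
by exists (- n); rewrite rmorphN.
Qed.

(* Chevalley's theorem: the constant is plus or minus the length of the lower
   part of the string. The top of the string pairs with [alpha] to [t = 1, 2, 3]
   and determines all the norms along the string. *)
Lemma structure_constant alpha beta : Rx alpha -> Rx beta -> Rx (alpha + beta) ->
  exists m : int, lie (x alpha) (x beta) = x (alpha + beta) *~ m.
Proof.
move=> Ra Rb Rab; have [ra rb] := (Rx_root Ra, Rx_root Rb).
have [N eN] := root_space_dim1 cs Rab (root_space_lie (chev_root cs Ra) (chev_root cs Rb)).
suff [m Nm] : exists m : int, N = m%:~R by exists m; rewrite eN Nm scaler_int.
have [N' [eN' NN']] := chev_norm Ra Rb Rab eN.
have sl2 := chev_sl2 cs Ra.
have [efl _ _] := sl2.
have feb : lie (x (- alpha)) (lie (x alpha) (x beta)) = (N * N') *: x beta.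
  by rewrite eN linearZ /= eN' scalerA.
have hb : lie (incl E (h_ alpha)) (x beta) = (pairing beta alpha)%:~R *: x beta.
  by rewrite (chev_root cs Rb) (pairingE cs).
have efb : lie (x alpha) (lie (x (- alpha)) (x beta)) = (N * N' + (pairing beta alpha)%:~R) *: x beta.
  by rewrite lie_leibniz efl hb feb scalerDl addrC.
have [q [q0 q1]] := last_nonzero_iter (chev_neq0 cs Rb) (chev_nilpotent cs Ra (x beta)).
have [r [r0 r1]] := last_nonzero_iter (chev_neq0 cs Rb) (chev_nilpotent cs (Rx_opp Ra) (x beta)).
have muq := sl2_string sl2 hb feb q0 q1.
have hb' : lie (- incl E (h_ alpha)) (x beta) = (- (pairing beta alpha)%:~R) *: x beta.
  by rewrite lieNl hb scaleNr.
have mur := sl2_string (sl2_tripleC sl2) hb' efb r0 r1.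
have re : roots E (beta + alpha *~ q).
  exists (iter q (lie (x alpha)) (x beta)) => //.
  exact: root_space_iter (chev_root cs Ra) (chev_root cs Rb).
have te : pairing (beta + alpha *~ q) alpha = pairing beta alpha + 2 * q%:Z.
  by rewrite (pairing_addMz cs) // (pairing_self cs) // mulrC.
(* With p the pairing, the difference of the two formulas for N N' factors as (r - p - q) (r + q +
   1), and the second factor is positive. *)
have rE : pairing beta alpha + q%:Z = r%:Z.
  have : (q%:Z + 1) * (pairing beta alpha + q%:Z) = r%:Z * (r%:Z - pairing beta alpha + 1).
    apply: (@intr_inj R[i]); rewrite !(rmorphM, rmorphD, rmorphN, rmorph1) /= -!pmulrn.
    move: mur; rewrite muq; move: (pairing _ _)%:~R => p e.
    by transitivity (r%:R * (- p + r%:R + 1) : R[i]); [rewrite -e|]; ring.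
  by nia.
case: (posnP q) => [q00|q_gt0].
  by exists 0; move: q1; rewrite q00 /= eN => /eqP; rewrite scaler_eq0 (negPf (chev_neq0 cs Rab)) orbF => /eqP.
have Re : Rx (beta + alpha *~ q) by apply: (Rx_of_pairing cs Ra re); rewrite te; lia.
have tse := pairing_mul_bound cs Ra Re.
have t4 := pairing_neq4 Ra Re.
have s4 := pairing_neq4 Re Ra.
have s0 : pairing alpha (beta + alpha *~ q) <> 0.
  by move=> /(pairing_eq0 cs Re Ra); rewrite te; lia.
have tA := pairing_form cs Ra re; have sE := pairing_form cs Re ra.
(* The string gives N N', and [chev_norm] eliminates N', so that N^2 is expressed by norms. *)
have muN : N ^+ 2 * dual_form beta beta =
    (q * (r + 1))%:R * dual_form (alpha + beta) (alpha + beta).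
  have -> : (q * (r + 1))%:R = N * N' :> R[i].
    rewrite muq natrM natrD; congr (_ * (_ + _)).
    by rewrite pmulrn -rE rmorphD.
  by rewrite expr2 -!mulrA NN'.
have bE : beta = beta + alpha *~ q + alpha *~ (- q%:Z) by rewrite mulrNz addrK.
have abE : alpha + beta = beta + alpha *~ q + alpha *~ (1 - q%:Z).
  by rewrite -addrA -mulrzDr addrC addrCA subrr addr0 mulr1z.
have normE k := dual_form_addMz k (Rx_represented Ra) (Rx_represented Re).
have B := normE (- q%:Z); rewrite -bE in B.
have D := normE (1 - q%:Z); rewrite -abE in D.
have {B D} [B D] : dual_form beta beta = dual_form (beta + alpha *~ q) (beta + alpha *~ q)
     - q%:R * (2 * dual_form (beta + alpha *~ q) alpha) + q%:R ^+ 2 * dual_form alpha alpha /\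
   dual_form (alpha + beta) (alpha + beta) = dual_form (beta + alpha *~ q) (beta + alpha *~ q)
     + (1 - q%:R) * (2 * dual_form (beta + alpha *~ q) alpha) + (1 - q%:R) ^+ 2 * dual_form alpha alpha.
  by rewrite B D !(rmorphN, rmorphB, rmorph1) /= -!pmulrn; split; ring.
have B0 := Rx_neq0 Rb; have D0 := Rx_neq0 Rab; have A0 := Rx_neq0 Ra; have E0 := Rx_neq0 Re.
rewrite (dual_formC alpha (_ + _ *~ _)) -tA in sE; rewrite -tA in B D.
have tE : pairing (beta + alpha *~ q) alpha = q%:Z + r%:Z by rewrite te; lia.
rewrite tE in t4 tse sE B D.
move: (pairing alpha (beta + alpha *~ q)) s0 s4 tse sE => s s0 s4 tse sE.
move: (dual_form alpha alpha) (dual_form beta beta) (dual_form (alpha + beta) (alpha + beta))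
  (dual_form (beta + alpha *~ q) (beta + alpha *~ q)) A0 B0 D0 E0 B D sE muN => A B D e A0 B0 D0 E0 BE DE sE muN.
clear - q_gt0 t4 s4 tse s0 A0 B0 D0 E0 BE DE sE muN.
(* [s] and q + r are the two pairings of [alpha] with the top of the string: their product is at
   most 4, and neither is 0 or 4. *)
have [s1|[[s2 qr]|[[s2 qr]|[s3 qr]]]] : s = 1 \/ (s = 2 /\ q%:Z + r%:Z = 1) \/
    (s = 2 /\ q%:Z + r%:Z = 2) \/ (s = 3 /\ q%:Z + r%:Z = 1) by nia.
- rewrite s1 mul1r in sE; rewrite sE in BE DE.
  have [[q1 r0]|[[q1 r1]|[[q1 r1]|[[q2 r0]|[[q2 r1]|[q3 r0]]]]]] :
    (q = 1 /\ r = 0 \/ q = 1 /\ r = 1 \/ q = 1 /\ r = 2 \/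
     q = 2 /\ r = 0 \/ q = 2 /\ r = 1 \/ q = 3 /\ r = 0)%N by lia.
  + subst q r; apply: (intr_of_sqr (n := 1)); apply: (mulIf B0); rewrite muN BE DE; ring.
  + subst q r; apply: (intr_of_sqr (n := 2)); apply: (mulIf B0); rewrite muN BE DE; ring.
  + subst q r; apply: (intr_of_sqr (n := 3)); apply: (mulIf B0); rewrite muN BE DE; ring.
  + subst q r; apply: (intr_of_sqr (n := 1)); apply: (mulIf B0); rewrite muN BE DE; ring.
  + subst q r; apply: (intr_of_sqr (n := 2)); apply: (mulIf B0); rewrite muN BE DE; ring.
  + subst q r; apply: (intr_of_sqr (n := 1)); apply: (mulIf B0); rewrite muN BE DE; ring.
- have [q1 r0] : q = 1%N /\ r = 0%N by lia.
  subst q r; apply: (intr_of_sqr (n := 1)); apply: (mulIf B0); rewrite muN BE DE; ring.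
(* Two pairings equal to 2 give [alpha] and the top equal norms, and then [beta] or [alpha + beta]
   would be isotropic. *)
- have eA : e = A.
    have two0 : 2 != 0 :> R[i] by rewrite pnatr_eq0.
    by apply: (mulfI two0); move: sE; rewrite s2 qr.
  have [[q1 r1]|[q2 r0]] : (q = 1 /\ r = 1 \/ q = 2 /\ r = 0)%N by lia.
    by subst q r; case/eqP: B0; rewrite BE eA; ring.
  by subst q r; case/eqP: D0; rewrite DE eA; ring.
- have [q1 r0] : q = 1%N /\ r = 0%N by lia.
  subst q r; apply: (intr_of_sqr (n := 1)); apply: (mulIf B0); rewrite muN BE DE; ring.
Qed.

End StructureConstants.

(** * Lifted reflections and integrality of the brackets in isotropic root spaces *)

Section IntegralBrackets.
Context {R : realType} (E : eala R) (tau : E -> E) (x : dual_cartan E -> E).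
Implicit Types (alpha beta gamma sigma : dual_cartan E) (u v z : E) (m : int).
Hypothesis ci : chevalley_involution tau.
Hypothesis cs : chevalley_system tau x.
Hypothesis no_double : forall alpha beta, Rx alpha -> Rx beta ->
  ~ isotropic_roots E (beta - alpha *~ 2).
Hypothesis transversal : forall alpha, Rx alpha -> exists gamma,
  [/\ Rx gamma, pairing alpha gamma != 0 &
      forall k l : int, zspan (isotropic_roots E) (gamma *~ k + alpha *~ l) -> k = 0].

(** Extension by zero frees the bracket formulas from the question whether an index is a root. *)
Definition chev alpha : E := if `[< Rx alpha >] then x alpha else 0.

Lemma chevE alpha : Rx alpha -> chev alpha = x alpha.
Proof. by rewrite /chev => /asboolT ->. Qed.

Lemma chev_out alpha : ~ Rx alpha -> chev alpha = 0.
Proof. by rewrite /chev => /asboolF ->. Qed.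

Lemma chev_root_space alpha : root_space alpha (chev alpha).
Proof.
case: (pselect (Rx alpha)) => Ra; first by rewrite chevE //; exact: (chev_root cs).
by rewrite chev_out //; exact: root_space0.
Qed.

Lemma chev_lie alpha beta : ~ isotropic_roots E (alpha + beta) ->
  exists m, lie (chev alpha) (chev beta) = chev (alpha + beta) *~ m.
Proof.
move=> nab; case: (pselect (Rx alpha)) => Ra; last first.
  by exists 0; rewrite (chev_out Ra) lie0l.
case: (pselect (Rx beta)) => Rb; last first.
  by exists 0; rewrite (chev_out Rb) linear0.
case: (pselect (Rx (alpha + beta))) => Rab.
  by rewrite !chevE //; exact: (structure_constant ci cs).
exists 0; rewrite mulr0z; apply: (@root_space_nonroot _ _ (alpha + beta)).
  by move=> /root_cases[/nab|/Rab].
exact: root_space_lie (chev_root_space _) (chev_root_space _).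
Qed.

Definition brk sigma alpha : E := lie (chev (alpha + sigma)) (chev (- alpha)).

Lemma brk_root_space sigma alpha : root_space sigma (brk sigma alpha).
Proof.
have := root_space_lie (chev_root_space (alpha + sigma)) (chev_root_space (- alpha)).
by rewrite addrAC subrr add0r.
Qed.

Lemma Rx_shift_not_iso beta sigma : Rx beta -> isotropic_roots E sigma ->
  ~ isotropic_roots E (beta + sigma).
Proof.
by move=> Rb s0 bs; have := Rx_shiftP cs Rb s0 (iso_root bs); move/Rx_not_iso; exact.
Qed.

(** The Leibniz rule yields two double brackets. The inner weights are non-isotropic by assumption
    and the outer weight is [beta + sigma], so [chev_lie] applies four times. *)
Lemma brk_integral_generic alpha beta sigma : Rx beta -> isotropic_roots E sigma ->
  ~ isotropic_roots E (beta - alpha) -> ~ isotropic_roots E (beta + (alpha + sigma)) ->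
  exists m, lie (chev beta) (brk sigma alpha) = chev (beta + sigma) *~ m.
Proof.
move=> Rb s0 nm np; have nbs := Rx_shift_not_iso Rb s0.
have [m1 e1] := chev_lie np; have [m2 e2] := chev_lie nm.
have bE1 : beta + (alpha + sigma) - alpha = beta + sigma.
  by rewrite [alpha + sigma]addrC addrA addrK.
have bE2 : alpha + sigma + (beta - alpha) = beta + sigma.
  by rewrite addrC addrA subrK.
have [|m3] := @chev_lie (beta + (alpha + sigma)) (- alpha); first by rewrite bE1.
rewrite bE1 => e3.
have [|m4] := @chev_lie (alpha + sigma) (beta - alpha); first by rewrite bE2.
rewrite bE2 => e4; exists (m3 * m1 + m4 * m2).
by rewrite lie_leibniz e1 e2 lieMzl lieMzr e3 e4 -!mulrzA mulrzDr.
Qed.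

Definition theta beta := reflection_aut (x beta) (x (- beta)).

Lemma dual_evalB alpha (h k : cartan E) (c : R[i]) :
  alpha (h - c *: k) = alpha h - c * alpha k.
Proof. by rewrite linearB [X in _ - X]linearZ. Qed.

Section Reflection.
Variable beta : dual_cartan E.
Hypothesis Rb : Rx beta.

Let sl2 := chev_sl2 cs Rb.
Let ne := chev_nilpotent cs Rb.
Let nf := chev_nilpotent cs (Rx_opp Rb).
Let nNf := ad_nilpotentN nf.

Lemma theta_lie u v : theta beta (lie u v) = lie (theta beta u) (theta beta v).
Proof. exact: reflection_aut_lie. Qed.

Lemma theta0 : theta beta 0 = 0.
Proof. by rewrite /theta /reflection_aut !exp_ad2 ?linear0. Qed.

Lemma thetaZ (c : R[i]) u : theta beta (c *: u) = c *: theta beta u.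
Proof.
have := @reflection_aut_linear _ _ _ _ ne nNf c u 0.
by rewrite addr0 -!/(theta _ _) theta0 addr0.
Qed.

Lemma theta_cartan (h : cartan E) :
  theta beta (incl E h) = incl E (h - beta h *: h_ beta).
Proof.
rewrite /theta (reflection_aut_cartan sl2 ne nNf (c := beta h)).
- by rewrite linearB [in RHS]linearZ.
- by rewrite lieC (chev_root cs Rb) scaleNr.
- by rewrite lieC (chev_opp cs Rb) dual_oppE scaleNr opprK.
Qed.

Lemma theta_root_space alpha u : root_space alpha u ->
  root_space (alpha - alpha (h_ beta) *: beta) (theta beta u).
Proof.
move=> au h; pose h' := h - beta h *: h_ beta.
(* [h'] is the reflection of [h], and this reflection is an involution. *)
have <- : theta beta (incl E h') = incl E h.
  rewrite theta_cartan; congr (incl E _); rewrite /h' dual_evalB h_self //.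
  have -> : beta h - beta h * 2 = - beta h by ring.
  by rewrite scaleNr opprK subrK.
rewrite -theta_lie au thetaZ; congr (_ *: _).
by rewrite /h' dual_evalB dual_addE dual_oppE dual_scaleE mulrC.
Qed.

Lemma theta_root alpha u : roots E alpha -> root_space alpha u ->
  root_space (root_reflection beta alpha) (theta beta u).
Proof.
by move=> ra /theta_root_space; rewrite (pairingE cs Rb ra) scaler_int.
Qed.

(** [tau] interchanges exp (ad x_beta) and exp (- ad x_(-beta)), so it turns the triple product into
    the one with exchanged roles, which is the same map by [reflection_aut_sym]. *)
Lemma tau_theta u : core E u -> tau (theta beta u) = theta beta (tau u).
Proof.
move=> cu; have [ce cf] := (core_chev cs Rb, core_chev cs (Rx_opp Rb)).
have [[[c0 cl] _] cN] := (core_subalgebra E, @coreN _ E).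
have expE v : core E v -> core E (exp_ad (x beta) v) /\
    tau (exp_ad (x beta) v) = exp_ad (- x (- beta)) (tau v).
  apply: exp_ad_intertwine => //.
  - by move=> c y w; exact: (tau_lin ci).
  - by move=> y cy; exact: core_lie.
  - by move=> y cy; rewrite (tau_lie ci) // (tau_chev cs).
have expF v : core E v -> core E (exp_ad (- x (- beta)) v) /\
    tau (exp_ad (- x (- beta)) v) = exp_ad (x beta) (tau v).
  apply: exp_ad_intertwine => //.
  - by move=> c y w; exact: (tau_lin ci).
  - by move=> y cy; apply: core_lie => //; exact: cN.
  - move=> y cy; rewrite (tau_lie ci) //; last exact: cN.
    by rewrite (tauN ci) // (tau_chev cs (Rx_opp Rb)) !opprK.
rewrite /theta -(reflection_aut_sym sl2 ne nNf (tau u)) /reflection_aut.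
have [c1 t1] := expE u cu; have [c2 t2] := expF _ c1; have [c3 t3] := expE _ c2.
by rewrite t3 t2 t1.
Qed.

(** Commutation with [tau] gives the same scalar for [alpha] and [- alpha]. Evaluating the reflected
    root on the image of [x_alpha, x_(-alpha)] = h_alpha shows that its square is 1. *)
Lemma theta_chev alpha : Rx alpha -> exists2 m, m = 1 \/ m = - 1 &
  theta beta (x alpha) = x (root_reflection beta alpha) *~ m /\
  theta beta (x (- alpha)) = x (- root_reflection beta alpha) *~ m.
Proof.
move=> Ra; set alpha' := root_reflection beta alpha.
have Ra' : Rx alpha' := root_reflection_Rx cs Rb Ra.
have [c ec] := root_space_dim1 cs Ra' (theta_root (Rx_root Ra) (chev_root cs Ra)).
have ec' : theta beta (x (- alpha)) = c *: x (- alpha').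
  have := tau_theta (core_chev cs Ra).
  rewrite ec (tauZ ci); last exact: (core_chev cs Ra').
  rewrite !(tau_chev cs) // scalerN -[- x (- alpha)]scaleN1r thetaZ scaleN1r.
  by move/oppr_inj => <-.
have cc : c ^+ 2 = 1 ^+ 2.
  have := theta_lie (x alpha) (x (- alpha)).
  rewrite ec ec' lieZl linearZ /= scalerA -expr2.
  have [-> _ _] := chev_sl2 cs Ra; have [-> _ _] := chev_sl2 cs Ra'.
  rewrite theta_cartan -[_ ^+ 2 *: _]linearZ => eH; have := congr1 alpha' (incl_inj (ealaP E) eH).
  rewrite [in RHS]linearZ /= h_self // dual_evalB.
  have alphaE' h : alpha' h = alpha h - (pairing alpha beta)%:~R * beta h.
    by rewrite /alpha' /root_reflection -mulrNz dual_addE dual_mulzE rmorphN mulNr.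
  rewrite !alphaE' !h_self // (pairingE cs Ra (Rx_root Rb)) (pairingE cs Rb (Rx_root Ra)).
  have two0 : 2 != 0 :> R[i] by rewrite pnatr_eq0.
  move=> e; apply: (mulIf two0); rewrite expr1n -[LHS]e; ring.
move/eqP: cc; rewrite eqf_sqr => /orP[/eqP c1|/eqP c1].
  by exists 1; [left|rewrite ec ec' c1 !scale1r !mulr1z].
by exists (- 1); [right|rewrite ec ec' c1 !scaleN1r !mulrN1z].
Qed.

Lemma theta_brk sigma alpha : Rx alpha -> isotropic_roots E sigma ->
  exists2 m, m = 1 \/ m = - 1 &
    theta beta (brk sigma alpha) = brk sigma (root_reflection beta alpha) *~ m.
Proof.
move=> Ra s0; have Ra' := root_reflection_Rx cs Rb Ra.
have [ra ra'] := (Rx_root Ra, Rx_root Ra').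
case: (pselect (Rx (alpha + sigma))) => Ras; last first.
  exists 1; first by left.
  (* Both brackets vanish: if the reflected root could be shifted by [sigma], reflecting back would
     shift [alpha]. *)
  rewrite /brk (chev_out Ras) lie0l theta0 chev_out ?lie0l ?mul0rz // => Ras'.
  apply: Ras; have := root_reflection_Rx cs Rb Ras'.
  rewrite (root_reflection_add cs Rb ra' s0) ?(root_reflectionK cs) //.
  exact: Rx_root.
have [m1 m1E [e1 _]] := theta_chev Ras; have [m2 m2E [_ e2]] := theta_chev Ra.
rewrite (root_reflection_add cs Rb ra s0 (Rx_root Ras)) in e1.
have Ras' := root_reflection_Rx cs Rb Ras.
rewrite (root_reflection_add cs Rb ra s0 (Rx_root Ras)) in Ras'.
exists (m1 * m2); first by case: m1E m2E => -> [] ->; [left|right|right|left].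
rewrite /brk !chevE //; try exact: Rx_opp.
by rewrite theta_lie e1 e2 lieMzl lieMzr -mulrzA mulrC.
Qed.

(** Such a root would have norm 4 (beta, beta), hence be non-isotropic and twice [beta] up to
    [sigma], against [no_double]. *)
Lemma double_shift_nonroot sigma : isotropic_roots E sigma -> ~ roots E (beta + (beta + sigma)).
Proof.
move=> s0; rewrite addrA; have -> : beta + beta + sigma = sigma + beta *~ 2 by rewrite addrC -mulr2n pmulrn.
move=> r; apply: (@no_double beta (sigma + beta *~ 2)) => //; last by rewrite addrK.
apply/RxP; split=> //.
rewrite (dual_form_addMz _ (Rx_represented Rb) (iso_represented s0)) (iso_form s0).
rewrite (dual_formC sigma) (isotropic_orthogonal cs Rb s0) !mulr0 !add0r.
by rewrite mulf_neq0 ?Rx_neq0 // expf_neq0 // pnatr_eq0.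
Qed.

End Reflection.

Lemma theta_isotropic beta sigma z m : Rx beta -> isotropic_roots E sigma ->
  root_space sigma z -> lie (chev beta) z = chev (beta + sigma) *~ m ->
  theta beta z = z + brk sigma beta *~ m.
Proof.
move=> Rb s0 sz ez; have Rnb := Rx_opp Rb.
have [rb rnb] := (chev_root cs Rb, chev_root cs Rnb).
rewrite /theta (reflection_aut_weight0 (chev_sl2 cs Rb)).
- rewrite -(chevE Rb) ez /brk lieMzr (chevE Rnb) (lieC (chev _)) mulNrz.
  by [].
- exact: (chev_nilpotent cs).
- exact/ad_nilpotentN/(chev_nilpotent cs Rnb).
- by rewrite sz (isotropic_h cs Rb s0) scale0r.
- apply: (root_space_nonroot (double_shift_nonroot Rb s0)).
  exact/root_space_lie/root_space_lie.
- apply: (root_space_nonroot (double_shift_nonroot Rnb s0)).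
  exact/root_space_lie/root_space_lie.
Qed.

Lemma brk_reflection_of_integral alpha beta sigma m : Rx alpha -> Rx beta ->
  isotropic_roots E sigma ->
  lie (chev beta) (brk sigma alpha) = chev (beta + sigma) *~ m ->
  exists n : int, brk sigma (root_reflection beta alpha) =
    (brk sigma alpha + brk sigma beta *~ m) *~ n.
Proof.
move=> Ra Rb s0 e; have [n n1 en] := theta_brk Rb Ra s0.
exists n; rewrite -(theta_isotropic Rb s0 (brk_root_space _ _) e) en -mulrzA.
by case: n1 => ->.
Qed.

Lemma zspan_isotropic_orthogonal alpha nu : Rx alpha ->
  zspan (isotropic_roots E) nu -> nu (h_ alpha) = 0.
Proof.
move=> Ra; move: nu; apply: zspan_ind.
- exact: dual_zeroE.
- by move=> u v u0 v0; rewrite dual_addE u0 v0 addr0.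
- by move=> u u0; rewrite dual_oppE u0 oppr0.
- by move=> u; exact: (isotropic_h cs Ra).
Qed.

Lemma brk_integral alpha beta sigma : Rx alpha -> Rx beta -> isotropic_roots E sigma ->
  exists m, lie (chev beta) (brk sigma alpha) = chev (beta + sigma) *~ m.
Proof.
move=> Ra Rb s0.
case: (pselect (exists2 n : int, n = 1 \/ n = - 1 &
    zspan (isotropic_roots E) (beta - alpha *~ n))) => [[n n1 Nb]|nN]; last first.
  apply: brk_integral_generic => // iso; apply: nN.
    by exists 1; [left|apply: zspan_gen; rewrite mulr1z].
  exists (- 1); [by right|rewrite mulrN1z opprK].
  have -> : beta + alpha = beta + (alpha + sigma) - sigma by rewrite addrA addrK.
  by apply: zspanB; apply: zspan_gen.
have [gamma [Rg m0 Ng]] := transversal Ra.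
(* Once the coefficient of gamma is zero, evaluation at h_alpha kills the other one, isotropic roots
   being orthogonal to [alpha]. *)
have {}Ng k l : zspan (isotropic_roots E) (gamma *~ k + alpha *~ l) -> k = 0 /\ l = 0.
  move=> Nkl; have k0 := Ng _ _ Nkl; split=> //.
  have := zspan_isotropic_orthogonal Ra Nkl.
  rewrite k0 mulr0z add0r dual_mulzE h_self // => /eqP.
  by rewrite mulf_eq0 pnatr_eq0 orbF intr_eq0 => /eqP.
(* Since [beta] is n alpha modulo isotropic roots, each obstruction to the generic case for the
   bracket of [w] becomes a relation between [w] and [alpha]. *)
have Nminus w : isotropic_roots E (beta - w) -> zspan (isotropic_roots E) (- w + alpha *~ n).
  move=> iso; have -> : - w + alpha *~ n = (beta - w) - (beta - alpha *~ n).
    by rewrite opprB [RHS]addrC addrA subrK addrC.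
  by apply: zspanB => //; apply: zspan_gen.
have Nplus w : isotropic_roots E (beta + (w + sigma)) -> zspan (isotropic_roots E) (w + alpha *~ n).
  move=> iso; have -> : w + alpha *~ n = (beta + (w + sigma)) - sigma - (beta - alpha *~ n).
    by rewrite addrA addrK opprB [RHS]addrC addrA subrK addrC.
  by apply: zspanB => //; apply: zspanB; apply: zspan_gen.
set p := pairing alpha gamma in m0.
pose alpha' := root_reflection gamma alpha.
have Ra' : Rx alpha' := root_reflection_Rx cs Rg Ra.
have [m1 e1] : exists m, lie (chev beta) (brk sigma gamma) = chev (beta + sigma) *~ m.
  apply: brk_integral_generic => //; first by move/Nminus; rewrite -mulrN1z => /Ng[].
  by move/Nplus; rewrite -[gamma]mulr1z => /Ng[].
have [m2 e2] : exists m, lie (chev beta) (brk sigma alpha') = chev (beta + sigma) *~ m.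
  apply: brk_integral_generic => //.
    move/Nminus; have -> : - alpha' + alpha *~ n = gamma *~ p + alpha *~ (n - 1).
      by rewrite opprB mulrzBr mulr1z -addrA [- alpha + _]addrC.
    by move=> /Ng[p0]; rewrite p0 in m0.
  move/Nplus; have -> : alpha' + alpha *~ n = gamma *~ (- p) + alpha *~ (n + 1).
    by rewrite mulrzDr mulr1z mulrNz addrC [X in _ = X]addrC addrA.
  by move=> /Ng[/eqP]; rewrite oppr_eq0 (negPf m0).
(* This bracket is what allows the reflection in gamma to be applied to [alpha'], which returns
   [alpha]. *)
have [m3 e3] : exists m, lie (chev gamma) (brk sigma alpha') = chev (gamma + sigma) *~ m.
  apply: brk_integral_generic => // /zspan_gen Nw.
    have : zspan (isotropic_roots E) (gamma *~ (1 + p) + alpha *~ (- 1)).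
      suff -> : gamma *~ (1 + p) + alpha *~ (- 1) = gamma - alpha' by [].
      by rewrite opprB mulrzDr mulr1z mulrN1z addrA.
    by move=> /Ng[].
  have : zspan (isotropic_roots E) (gamma *~ (1 - p) + alpha *~ 1).
    have -> : gamma *~ (1 - p) + alpha *~ 1 = gamma + (alpha' + sigma) - sigma.
      by rewrite addrA addrK mulrzBr !mulr1z -addrA [- _ + _]addrC.
    by apply: zspanB => //; apply: zspan_gen.
  by move=> /Ng[].
have [n' en'] := brk_reflection_of_integral Ra' Rg s0 e3.
rewrite (root_reflectionK cs Rg (Rx_root Ra)) in en'; exists ((m2 + m1 * m3) * n').
by rewrite en' lieMzr linearD /= lieMzr e1 e2 -!mulrzA -mulrzDr -mulrzA.
Qed.

Lemma brk_reflection alpha beta sigma : Rx alpha -> Rx beta -> isotropic_roots E sigma ->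
  exists m n : int, brk sigma (root_reflection beta alpha) =
    (brk sigma alpha + brk sigma beta *~ m) *~ n.
Proof.
move=> Ra Rb s0; have [m e] := brk_integral Ra Rb s0.
by exists m; exact: brk_reflection_of_integral Ra Rb s0 e.
Qed.

End IntegralBrackets.

(** * Closure properties of linear spans *)

Section LinearSpans.
Context {K : pzRingType} {V : lmodType K}.
Implicit Types (A : set V) (u v : V).

Lemma lspan_lin A (k : K) u v : lspan A u -> lspan A v -> lspan A (k *: u + v).
Proof.
have [_ cl] := in_span_submod A.
by move=> Au Av; apply/asboolP/(cl k); apply/asboolP.
Qed.

Lemma lspan0 A : lspan A 0.
Proof. by have [c0 _] := in_span_submod A; exact/asboolP. Qed.

Lemma lspanZ A (k : K) u : lspan A u -> lspan A (k *: u).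
Proof. by move=> Au; rewrite -[k *: u]addr0; apply: lspan_lin => //; exact: lspan0. Qed.

Lemma lspanD A u v : lspan A u -> lspan A v -> lspan A (u + v).
Proof. by move=> Au; rewrite -[u]scale1r; exact: lspan_lin. Qed.

Lemma lspanB A u v : lspan A u -> lspan A v -> lspan A (u - v).
Proof. by move=> Au Av; rewrite addrC -scaleN1r; exact: lspan_lin. Qed.

Lemma lspan_gen A v : A v -> lspan A v.
Proof.
move=> Av; exists 1%N, (fun=> 1), (fun=> v); split=> //.
by rewrite big_ord1 scale1r.
Qed.

Lemma lspan_ind A (P : V -> Prop) : P 0 ->
  (forall k u v, P u -> P v -> P (k *: u + v)) -> (forall v, A v -> P v) ->
  forall v, lspan A v -> P v.
Proof.
move=> P0 Plin PA _ [n [c [a [Aa ->]]]]; apply: big_rec => // i v _ Pv.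
by apply: Plin Pv; exact: PA.
Qed.

End LinearSpans.

(** * The span of the isotropic roots; consequences of reduced type and of rank above 1 *)

Section NullSpace.
Context {R : realType} (E : eala R) (tau : E -> E) (x : dual_cartan E -> E).
Implicit Types (alpha beta gamma sigma nu : dual_cartan E).
Hypothesis cs : chevalley_system tau x.

Lemma real_lspan_ind (A : set (dual_cartan E)) (P : dual_cartan E -> Prop) : P 0 ->
  (forall (k : R) u v, P u -> P v -> P (k%:C%C *: u + v)) -> (forall v, A v -> P v) ->
  forall v, lspan (A : set (realified (dual_cartan E))) v -> P v.
Proof. by move=> P0 Plin PA; exact: (@lspan_ind _ (realified (dual_cartan E)) A P P0 Plin PA). Qed.

(* V^0 inside the dual of H *)
Definition null_weight nu :=
  lspan (isotropic_roots E : set (realified (dual_cartan E))) nu.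

Lemma null_weight_lin (k : R) alpha beta :
  null_weight alpha -> null_weight beta -> null_weight (k%:C%C *: alpha + beta).
Proof. exact: lspan_lin. Qed.

Lemma null_weightZ (k : R) alpha : null_weight alpha -> null_weight (k%:C%C *: alpha).
Proof. exact: lspanZ. Qed.

Lemma null_weight0 : null_weight 0. Proof. exact: lspan0. Qed.

Lemma null_weightP (v : root_span E) : null v <-> null_weight (weight v).
Proof.
split=> [[s sv]|vN].
  by rewrite /weight -sv; have := span_valP s => /asboolP.
have sP : (weight v : realified (dual_cartan E)) \in
    in_span (isotropic_roots E : set (realified (dual_cartan E))) by apply/asboolP.
by exists (SpanType sP).
Qed.

Lemma root_span_lift alpha : roots E alpha -> exists v : root_span E, weight v = alpha.
Proof.
move=> ra; have sP : (alpha : realified (dual_cartan E)) \in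
    in_span (roots E : set (realified (dual_cartan E))).
  by apply/asboolP; exact: lspan_gen.
by exists (SpanType sP).
Qed.

Lemma weight_lin (c : R) (u v : root_span E) :
  weight (c *: u + v) = c%:C%C *: weight u + weight v.
Proof. by []. Qed.

Lemma weightZ (c : R) (u : root_span E) : weight (c *: u) = c%:C%C *: weight u.
Proof. by []. Qed.

Lemma weightB (u v : root_span E) : weight (u - v) = weight u - weight v.
Proof. by []. Qed.

Lemma weight_inj : injective (@weight R E).
Proof. by move=> u v; exact: val_inj. Qed.

Lemma null_weight_orthogonal alpha nu : Rx alpha -> null_weight nu -> nu (h_ alpha) = 0.
Proof.
move=> Ra; move: nu; apply: real_lspan_ind.
- exact: dual_zeroE.
- by move=> k u v u0 v0; rewrite dual_addE dual_scaleE u0 v0 mulr0 addr0.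
- by move=> v; exact: (isotropic_h cs).
Qed.

Lemma Rx_not_null alpha : Rx alpha -> ~ null_weight alpha.
Proof.
move=> Ra /(null_weight_orthogonal Ra); rewrite h_self // => /eqP.
by rewrite pnatr_eq0.
Qed.

Lemma null_weight_zspan nu : zspan (isotropic_roots E) nu -> null_weight nu.
Proof.
move: nu; apply: zspan_ind.
- exact: lspan0.
- by move=> u v u0 v0; exact: lspanD.
- by move=> v v0; rewrite -sub0r; apply: lspanB => //; exact: lspan0.
- by move=> v v0; exact: lspan_gen.
Qed.

(** The classes of [alpha] and [beta] modulo V^0 would have ratio 2, which [reduced_type]
    excludes. *)
Lemma reduced_no_double : reduced_type E -> forall alpha beta, Rx alpha -> Rx beta ->
  ~ isotropic_roots E (beta - alpha *~ 2).
Proof.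
move=> red alpha beta Ra Rb iso.
have [a ea] := root_span_lift (Rx_root Ra); have [b eb] := root_span_lift (Rx_root Rb).
have na : ~ null a by move/null_weightP; rewrite ea; exact: Rx_not_null.
have nb : ~ null b by move/null_weightP; rewrite eb; exact: Rx_not_null.
have [] // := @red a b 2; rewrite /root_vec /= ?ea ?eb; try exact: Rx_root.
- apply/null_weightP; rewrite weightB weightZ ea eb rmorph_nat.
  by apply: lspan_gen; move: iso; rewrite -[alpha *~ 2]scaler_int.
- by move/eqP; rewrite -subr_eq0 (_ : 2 - 1 = 1) ?oner_eq0 //; ring.
- by move/eqP; rewrite -subr_eq0 opprK natr1 pnatr_eq0.
Qed.

(** Otherwise every element of V is a real multiple of [alpha] modulo V^0, and two members of the
    basis [b] are dependent. *)
Lemma rank_gt1_not_line n alpha : has_rank E n -> (1 < n)%N ->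
  exists2 gamma, roots E gamma & forall c : R, ~ null_weight (gamma - c%:C%C *: alpha).
Proof.
move=> [b bP] n1; apply/not_exists2P => line.
have {}line gamma : roots E gamma -> exists c : R, null_weight (gamma - c%:C%C *: alpha).
  move=> rg; have [//|nl] := line gamma.
  by apply: contrapT => ne; apply: nl => c nc; apply: ne; exists c.
have lineV (v : root_span E) : exists c : R, null_weight (weight v - c%:C%C *: alpha).
  have /asboolP := span_valP v; rewrite -/(weight v); move: (weight v).
  apply: real_lspan_ind => //.
  - by exists 0; rewrite rmorph0 scale0r subr0; exact: null_weight0.
  - move=> k u w [c cu] [d dw]; exists (k * c + d).
    have := null_weight_lin k cu dw.
    by rewrite scalerBr scalerA rmorphD rmorphM scalerDl opprD addrACA.
have free (c : 'rV[R]_n) : null_weight (weight (\sum_i c 0 i *: b i)) -> c = 0.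
  move=> Nc; have [c0 [_ uniq_c]] := bP 0.
  rewrite -(uniq_c c) ?(uniq_c 0) //.
    apply/null_weightP; rewrite big1 ?subr0; first exact: null_weight0.
    by move=> i _; rewrite mxE scale0r.
  apply/null_weightP; rewrite sub0r -scaleN1r weightZ rmorphN1 -[_ *: _]addr0.
  by rewrite -(rmorphN1 (real_complex R)); apply: null_weight_lin => //; exact: null_weight0.
pose i0 : 'I_n := Ordinal (ltnW n1); pose i1 : 'I_n := Ordinal n1.
have sum_delta (c : R) i : \sum_j (c *: delta_mx 0 i : 'rV[R]_n) 0 j *: b j = c *: b i.
  rewrite (bigD1 i) //= big1 ?addr0; first by rewrite !mxE !eqxx mulr1.
  by move=> j ji; rewrite !mxE (negPf ji) andbF mulr0 scale0r.
have [[r0 N0] [r1 N1]] := (lineV (b i0), lineV (b i1)).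
(* [b i0] and [b i1] are r0 alpha and r1 alpha modulo V^0, so the combination with these
   coefficients is null. *)
have : r1 *: delta_mx 0 i0 + (- r0) *: delta_mx 0 i1 = 0 :> 'rV[R]_n.
  apply: free; under eq_bigr do rewrite mxE scalerDl.
  rewrite big_split /= !sum_delta weight_lin weightZ.
  have := null_weight_lin r1 N0 (null_weightZ (- r0) N1).
  rewrite (rmorphN (real_complex R)).
  rewrite 2!scalerBr 2!scalerA mulNr (scaleNr (_ * _)) opprK [_%:C%C * _]mulrC.
  by rewrite addrACA addNr addr0.
move/rowP => rr; have r1_0 : r1 = 0.
  by have := rr i0; rewrite !mxE !eqxx /= mulr1 mulr0 addr0.
have : delta_mx 0 i0 = 0 :> 'rV[R]_n.
  apply: free; rewrite -[delta_mx _ _]scale1r sum_delta scale1r.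
  have r0_0 : r0 = 0.
    by have := rr i1; rewrite !mxE !eqxx /= mulr1 mulr0 add0r => /eqP; rewrite oppr_eq0 => /eqP.
  by move: N0; rewrite r0_0 rmorph0 scale0r subr0.
by move/rowP/(_ i0); rewrite !mxE !eqxx => /eqP; rewrite oner_eq0.
Qed.

(** Split the non-isotropic roots into those on the line of [alpha] modulo V^0 and the others.
    Without such a gamma, every root not orthogonal to [alpha] would lie on the line, so the two
    parts would be orthogonal, against indecomposability. *)
Lemma exists_transversal n : has_rank E n -> (1 < n)%N -> forall alpha, Rx alpha ->
  exists gamma, [/\ Rx gamma, pairing alpha gamma != 0 &
    forall k l : int, zspan (isotropic_roots E) (gamma *~ k + alpha *~ l) -> k = 0].
Proof.
move=> rk n1 alpha Ra; apply: contrapT => nt.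
pose on_line gamma := exists c : R, null_weight (gamma - c%:C%C *: alpha).
have line_root gamma : Rx gamma -> pairing alpha gamma != 0 -> on_line gamma.
  move=> Rg p0; apply: contrapT => nl; apply: nt; exists gamma; split=> // k l Nkl.
  apply: contrapT => k0; apply: nl; exists (- (l%:~R / k%:~R)).
  have k0' : (k%:~R : R) != 0 by rewrite intr_eq0; apply/eqP.
  have := null_weightZ (k%:~R)^-1 (null_weight_zspan Nkl).
  rewrite scalerDr -[gamma *~ k]scaler_int -[alpha *~ l]scaler_int !scalerA.
  rewrite -!(rmorph_int (real_complex R)) -!rmorphM /= mulVf // rmorph1 scale1r.
  by rewrite rmorphN scaleNr opprK mulrC.
have [gamma rg ng] := rank_gt1_not_line alpha rk n1.
have Rg : Rx gamma.
  case: (root_cases rg) => // g0; case: (ng 0); rewrite rmorph0 scale0r subr0.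
  exact: lspan_gen.
have [||||d [g [[Rd [c dc]] [Rg' ng'] dg]]] :=
    @roots_indecomposable _ _ (ealaP E) (nonisotropic_roots E `&` on_line) (nonisotropic_roots E `\` on_line).
- by apply/seteqP; split=> [a [[]|[]]//|a Ra']; case: (pselect (on_line a)); [left|right].
- by apply/seteqP; split=> // a [[_ +] [_]].
- by exists alpha; split=> //; exists 1; rewrite rmorph1 scale1r subrr; exact: null_weight0.
- by exists gamma; split=> // -[c]; exact: ng.
apply: ng'; apply: line_root => //; apply: contraNneq dg => p0.
have d0 : d (h_ g) = 0.
  have := null_weight_orthogonal Rg' dc.
  rewrite dual_addE dual_oppE dual_scaleE (pairingE cs Rg' (Rx_root Ra)) p0.
  by rewrite mulr0 subr0.
move: d0; rewrite h_pairing; last exact: Rx_represented.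
move/eqP; rewrite mulf_eq0 mulf_eq0 pnatr_eq0 invr_eq0 (negPf (Rx_neq0 Rg')) /=.
by [].
Qed.

End NullSpace.

(** * Closure of a set of roots under its own reflections *)

Section ReflectionClosure.
Context {R : realType} (E : eala R) (tau : E -> E) (x : dual_cartan E -> E).
Implicit Types (alpha beta gamma sigma delta rho : dual_cartan E) (P Q : set (dual_cartan E)).
Hypothesis cs : chevalley_system tau x.

(** Describes W_P P by successive reflections acting on the dual of H itself; [reach_of_reflectable]
    and [reflectable_of_reach] compare it with the group acting on [hyp_span]. *)
Inductive reach P : dual_cartan E -> Prop :=
| reach_base alpha : P alpha -> reach P alpha
| reach_step alpha beta : reach P alpha -> P beta -> reach P (root_reflection beta alpha).

Lemma reach_Rx P : P `<=` nonisotropic_roots E -> reach P `<=` nonisotropic_roots E.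
Proof.
move=> PR alpha; elim=> {alpha} [alpha /PR//|alpha beta _ Ra /PR Rb].
exact: (root_reflection_Rx cs).
Qed.

(** Serves in place of the span of the isotropic roots: equality of pairings shows directly that a
    difference of roots lies in it. *)
Definition radical delta := forall alpha, Rx alpha -> delta (h_ alpha) = 0.

Lemma radicalD delta rho : radical delta -> radical rho -> radical (delta + rho).
Proof. by move=> d0 r0 alpha Ra; rewrite dual_addE d0 // r0 // addr0. Qed.

Lemma radicalMz delta (m : int) : radical delta -> radical (delta *~ m).
Proof. by move=> d0 alpha Ra; rewrite dual_mulzE d0 // mulr0. Qed.

Lemma radical_sum (I : Type) (r : seq I) (F : I -> dual_cartan E) :
  (forall i, radical (F i)) -> radical (\sum_(i <- r) F i).
Proof.
move=> F0; apply: big_ind => // [alpha _|]; first exact: dual_zeroE.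
exact: radicalD.
Qed.

Lemma reflection_same_class rho sigma delta : Rx rho -> Rx (rho + sigma) ->
  radical sigma -> radical delta ->
  (roots E (rho + delta) -> root_reflection (rho + sigma) (rho + delta) =
    - rho + (delta - sigma *~ 2)) /\
  (roots E (- rho + delta) -> root_reflection (rho + sigma) (- rho + delta) =
    rho + (delta + sigma *~ 2)).
Proof.
move=> Rr Rrs s0 d0.
have rh : rho (h_ (rho + sigma)) = 2.
  by have := h_self Rrs; rewrite dual_addE s0 // addr0.
split=> ra; rewrite /root_reflection.
  rewrite (@pairing_unique _ _ _ _ cs _ _ 2) //; last by rewrite dual_addE d0 // addr0.
  by rewrite mulrzDl opprD addrACA -{1}[rho]mulr1z -mulrzBr mulrN1z.
rewrite (@pairing_unique _ _ _ _ cs _ _ (- 2)) //; last first.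
  by rewrite dual_addE d0 // addr0 dual_oppE rh rmorphN.
rewrite mulrNz opprK mulrzDl addrACA; congr (_ + _).
by rewrite -mulrN1z -mulrzDr mulr1z.
Qed.

(* The product of the reflections in [rho] and [rho + sigma] translates the
   class of [rho] modulo the radical by [2 sigma]. *)
Lemma translate_class Q rho sigma : Rx rho -> Rx (rho + sigma) -> radical sigma ->
  Q `<=` nonisotropic_roots E ->
  (forall alpha, Q alpha -> Q (root_reflection rho alpha)) ->
  (forall alpha, Q alpha -> Q (root_reflection (rho + sigma) alpha)) ->
  forall (k : int) delta, radical delta -> Q (rho + delta) ->
  Q (rho + (delta + sigma *~ (2 * k))).
Proof.
move=> Rr Rrs s0 QR Qr Qrs k delta d0 Qd.
have rad0 : radical (0 : dual_cartan E) by move=> a _; exact: dual_zeroE.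
have Rr0 : Rx (rho + 0) by rewrite addr0.
(* [up] reflects first in [rho] and then in [rho + sigma]; [down] takes the opposite order. *)
have up eps : radical eps -> Q (rho + eps) -> Q (rho + (eps + sigma *~ 2)).
  move=> e0 Qe; have [+ _] := reflection_same_class Rr Rr0 rad0 e0.
  rewrite mul0rz subr0 addr0 => e1; have := Qr _ Qe; rewrite e1; last by case: (QR _ Qe).
  move=> Qe1; have [_ +] := reflection_same_class Rr Rrs s0 e0.
  by move=> e2; have := Qrs _ Qe1; rewrite e2 //; case: (QR _ Qe1).
have down eps : radical eps -> Q (rho + eps) -> Q (rho + (eps - sigma *~ 2)).
  move=> e0 Qe; have [+ _] := reflection_same_class Rr Rrs s0 e0.
  move=> e1; have := Qrs _ Qe; rewrite e1; last by case: (QR _ Qe).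
  have e0' : radical (eps - sigma *~ 2).
    by rewrite -mulrNz; apply: radicalD => //; exact: radicalMz.
  move=> Qe1; have [_ +] := reflection_same_class Rr Rr0 rad0 e0'.
  rewrite mul0rz !addr0 => e2; have := Qr _ Qe1; rewrite e2 //; by case: (QR _ Qe1).
have walk (n : nat) : Q (rho + (delta + sigma *~ (2 * n%:Z))) /\
    Q (rho + (delta + sigma *~ (2 * - n%:Z))).
  elim: n => [|n [IHp IHm]]; first by rewrite mulr0 mulr0z addr0.
  have rad m : radical (delta + sigma *~ m) by apply: radicalD => //; exact: radicalMz.
  have := up _ (rad _) IHp; have := down _ (rad _) IHm.
  rewrite -!addrA -mulrzBr -mulrzDr.
  have -> : 2 * n%:Z + 2 = 2 * n.+1%:Z by lia.
  by have -> : 2 * - n%:Z - 2 = 2 * - n.+1%:Z by lia.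
by case: k => n; [case: (walk n)|rewrite NegzE; case: (walk n.+1)].
Qed.

Lemma zspan_seqE (M : zmodType) (s : seq M) v : zspan [set` s] v ->
  exists c : 'I_(size s) -> int, v = \sum_(i < size s) s`_i *~ c i.
Proof.
move: v; apply: zspan_ind.
- by exists (fun=> 0); rewrite big1.
- move=> u v [c ->] [d ->]; exists (fun i => c i + d i).
  by rewrite -big_split; apply: eq_bigr => i _; rewrite mulrzDr.
- move=> v [c ->]; exists (fun i => - c i).
  by rewrite -sumrN; apply: eq_bigr => i _; rewrite mulrNz.
- move=> v /= vs; have iv : (index v s < size s)%N by rewrite index_mem.
  exists (fun i => if i == Ordinal iv then 1 else 0).
  rewrite (bigD1 (Ordinal iv)) //= eqxx mulr1z nth_index // big1 ?addr0 // => i /negPf->.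
  by rewrite mulr0z.
Qed.

Lemma zspan_root_noetherian (A : set (dual_cartan E)) : A `<=` zspan (roots E) ->
  exists s : seq (dual_cartan E), [set` s] `<=` A /\ A `<=` zspan [set` s].
Proof.
have [n [b [<- _]]] := root_lattice_free (ealaP E).
by move=> /zspan_noetherian[s sA As]; exists s.
Qed.

(* Finitely many classes modulo the radical, since pairings are bounded, and
   finitely many orbits of translations in each of them. *)
Lemma finite_reach : exists P, [/\ finite_set P, P `<=` nonisotropic_roots E &
  forall alpha, Rx alpha -> reach P alpha].
Proof.
have [s [sR Rs]] : exists s : seq (dual_cartan E),
    [set` s] `<=` nonisotropic_roots E /\ nonisotropic_roots E `<=` zspan [set` s].
  by apply: zspan_root_noetherian => a /Rx_root ra; exact: zspan_gen.
have Rsi (i : 'I_(size s)) : Rx s`_i by apply: sR; rewrite /= mem_nth.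
(* By [pairing_bound], the shift by 6 puts every pairing in the range from 0 to 12, whence the 13
   values. *)
pose cl beta : {ffun 'I_(size s) -> 'I_13} := [ffun i : 'I_(size s) => inord (absz (pairing beta s`_i + 6))].
have cl_radical beta gamma : Rx beta -> Rx gamma -> cl beta = cl gamma -> radical (beta - gamma).
  move=> Rb Rg /ffunP clE; have [rb rg] := (Rx_represented Rb, Rx_represented Rg).
  have rd : represented (beta - gamma).
    by apply: represented_add => //; exact: represented_opp.
  have si (i : 'I_(size s)) : dual_form s`_i (beta - gamma) = 0.
    have pE : pairing beta s`_i = pairing gamma s`_i.
      have := clE i; rewrite !ffunE => /(congr1 (@nat_of_ord _)); rewrite !inordK.
      - have := pairing_bound cs (Rsi i) Rb; have := pairing_bound cs (Rsi i) Rg; lia.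
      - have := pairing_bound cs (Rsi i) Rg; lia.
      - have := pairing_bound cs (Rsi i) Rb; lia.
    have two0 : 2 != 0 :> R[i] by rewrite pnatr_eq0.
    apply: (mulfI two0); rewrite mulr0 dual_formC dual_formDl //; last exact: represented_opp.
    rewrite dual_formNl // mulrBr -!(pairing_form cs) ?pE ?subrr //; exact: Rx_root.
  have all0 a : zspan [set` s] a -> a (t_ (beta - gamma)) = 0.
    move: a; apply: zspan_ind.
    - exact: dual_zeroE.
    - by move=> u v u0 v0; rewrite dual_addE u0 v0 addr0.
    - by move=> u u0; rewrite dual_oppE u0 oppr0.
    - move=> u /= us; have iu : (index u s < size s)%N by rewrite index_mem.
      have := si (Ordinal iu); rewrite /= nth_index // dual_formE //.
      by apply: Rx_represented; exact: sR.
  move=> a Ra; rewrite h_pairing // (dual_formC (beta - gamma)).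
  rewrite (@dual_formE _ _ a (beta - gamma)); last exact: Rx_represented.
  by rewrite all0 ?mulr0 //; exact: Rs.
pose rep c : dual_cartan E := xget 0 [set beta | Rx beta /\ cl beta = c].
have repP beta : Rx beta -> Rx (rep (cl beta)) /\ cl (rep (cl beta)) = cl beta.
  by move=> Rb; rewrite /rep; case: xgetP => // /(_ beta) [].
pose cls c := [set beta - rep c | beta in [set beta | Rx beta /\ cl beta = c]].
have /choice[sig sigP] c : exists t : seq (dual_cartan E),
    [set` t] `<=` cls c /\ cls c `<=` zspan [set` t].
  apply: zspan_root_noetherian => _ [beta [Rb <-] <-]; have [Rr _] := repP _ Rb.
  by apply: zspanB; apply/zspan_gen/Rx_root.
(* The points with coordinates 0 or 1 along the generators of the class: representatives modulo the
   translations by twice a generator. *)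
pose pt c (e : {ffun 'I_(size (sig c)) -> bool}) : dual_cartan E :=
  rep c + \sum_(i < size (sig c)) (sig c)`_i *~ (e i : nat).
exists ((\bigcup_(c in [set: {ffun 'I_(size s) -> 'I_13}]) (pt c @` setT)) `&` nonisotropic_roots E).
set P := _ `&` _.
split; first by apply: finite_setIl; apply: bigcup_finite => // c _; exact: finite_image.
  by move=> a [].
move=> beta Rb; set c := cl beta; have [Rr rcl] := repP _ Rb; rewrite -/c in Rr rcl.
have [sig_sub sub_sig] := sigP c.
have sig_mem i : (i < size (sig c))%N -> radical (sig c)`_i /\ Rx (rep c + (sig c)`_i).
  move=> ilt; have [|b [Rb' clb] <-] := sig_sub (sig c)`_i; first by rewrite /= mem_nth.
  by rewrite addrCA subrr addr0; split=> //; apply: cl_radical; rewrite // clb rcl.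
have [n nE] : exists n : 'I_(size (sig c)) -> int, beta - rep c = \sum_(i < size (sig c)) (sig c)`_i *~ n i.
  by apply/zspan_seqE/sub_sig; exists beta.
pose e : {ffun 'I_(size (sig c)) -> bool} := [ffun i : 'I_(size (sig c)) => odd (absz (n i))].
have /choice[k kE] (i : 'I_(size (sig c))) : exists k, n i = (e i : nat)%:Z + 2 * k.
  rewrite ffunE; exists ((n i - (odd (absz (n i)) : nat)%:Z) %/ 2)%Z.
  by case: (boolP (odd _)) => o /=; lia.
have P_pt e' : Rx (pt c e') -> P (pt c e').
  by move=> Re; split=> //; exists c => //; exists e'.
(* Translation by twice a generator needs the reflections in [rep c] and in [rep c] plus that
   generator, so both must lie in [P]. *)
have P_rep : P (rep c).
  have -> : rep c = pt c [ffun=> false].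
    by rewrite /pt big1 ?addr0 // => i _; rewrite ffunE.
  by apply: P_pt; rewrite /pt big1 ?addr0 // => i _; rewrite ffunE.
have P_sig i : (i < size (sig c))%N -> P (rep c + (sig c)`_i).
  move=> ilt; have ptE : pt c [ffun j : 'I_(size (sig c)) => j == Ordinal ilt] = rep c + (sig c)`_i.
    rewrite /pt (bigD1 (Ordinal ilt)) //= ffunE eqxx mulr1z big1 ?addr0 // => j.
    by rewrite ffunE => /negPf->.
  by rewrite -ptE; apply: P_pt; rewrite ptE; case: (sig_mem i ilt).
have translate Q : Q `<=` nonisotropic_roots E ->
    (forall gamma alpha, P gamma -> Q alpha -> Q (root_reflection gamma alpha)) ->
    forall (l : 'I_(size (sig c)) -> int) delta, radical delta -> Q (rep c + delta) ->
    Q (rep c + (delta + \sum_(i < size (sig c)) (sig c)`_i *~ (2 * l i))).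
  move=> QR QP l; elim: index_enum => [|i r IH] delta d0 Qd; first by rewrite big_nil addr0.
  have [si0 Rsig] := sig_mem i (ltn_ord i).
  rewrite big_cons [delta + (_ + _)]addrA; apply: IH; first by apply: radicalD => //; exact: radicalMz.
  by apply: translate_class => // alpha; apply: QP => //; exact: P_sig.
have sum_split : \sum_(i < size (sig c)) (sig c)`_i *~ n i =
    \sum_(i < size (sig c)) (sig c)`_i *~ (e i : nat) + \sum_(i < size (sig c)) (sig c)`_i *~ (2 * k i).
  by rewrite -big_split; apply: eq_bigr => i _; rewrite kE mulrzDr.
have e_rad : radical (\sum_(i < size (sig c)) (sig c)`_i *~ (e i : nat)).
  by apply: radical_sum => i; apply: radicalMz; case: (sig_mem i (ltn_ord i)).
(* A representative plus a sum of generators need not be a root; this one is, being [beta]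
   translated back by multiples of twice the generators. *)
have Re : Rx (pt c e).
  have cancel : \sum_(i < size (sig c)) (sig c)`_i *~ (2 * k i) +
      \sum_(i < size (sig c)) (sig c)`_i *~ (2 * - k i) = 0.
    by rewrite -big_split /= big1 // => i _; rewrite -mulrzDr mulrN addrN.
  have -> : pt c e = rep c + ((beta - rep c) +
      \sum_(i < size (sig c)) (sig c)`_i *~ (2 * - k i)).
    by rewrite /pt nE sum_split -addrA cancel addr0.
  apply: (translate (nonisotropic_roots E)) => //.
  - by move=> g a [_ Rg] Ra; exact: (root_reflection_Rx cs).
  - by apply: cl_radical; rewrite // rcl.
  - by rewrite addrCA subrr addr0.
have := translate (reach P) _ _ k _ e_rad (reach_base (P_pt e Re)).
rewrite -sum_split -nE addrCA subrr addr0; apply.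
  by apply: reach_Rx => a [].
by move=> g a Pg; move/reach_step; apply.
Qed.

End ReflectionClosure.

(** * Comparison with reflectable bases, and attainment of the minimum *)

Section ReflectableSets.
Context {R : realType} (E : eala R) (tau : E -> E) (x : dual_cartan E -> E) (S : splitting E).
Implicit Types (alpha beta : dual_cartan E) (a b v : root_span E) (Pi : set (root_span E)).
Hypothesis cs : chevalley_system tau x.

Lemma in_hyp_inj : injective (@in_hyp R E).
Proof. by move=> u v []. Qed.

Lemma weightMz v (m : int) : weight (v *~ m) = weight v *~ m.
Proof. by rewrite -[v *~ m]scaler_int weightZ rmorph_int scaler_int. Qed.

(** The component in the dual of V^0 is zero and [form_scale] cancels in the quotient, which leaves
    the Cartan integer as coefficient. *)
Lemma reflection_in_hyp a v : Rx (weight a) -> roots E (weight v) ->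
  reflection S a (in_hyp v) = in_hyp (v - a *~ pairing (weight v) (weight a)).
Proof.
move=> Ra rv; rewrite /reflection /in_hyp /=; congr (_ - _, _).
rewrite -[RHS]scaler_int; congr (_ *: _); rewrite /hyp_form /= !addr0.
apply: (@complexI R); rewrite rmorph_int.
rewrite fmorph_div rmorphM /= !(real_formE S) rmorph_nat.
rewrite -(pairingE cs) // h_pairing; last exact: root_represented.
have := form_scale_neq0 S; have := Rx_neq0 Ra.
move: (form_scale S) (dual_form _ _) (dual_form _ _) => c p q q0 c0.
by field; rewrite q0 c0.
Qed.

Lemma weight_reflection a v : weight (v - a *~ pairing (weight v) (weight a)) =
  root_reflection (weight a) (weight v).
Proof. by rewrite weightB weightMz. Qed.

(** The maps with image of [A] equal to [A] form a transformation group; equality, and not mere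
    inclusion, is what passes to inverses. *)
Lemma weyl_group_image Pi (A : set (@hyp_span R E)) :
  (forall a, Pi a -> reflection S a @` A = A) ->
  forall w, weyl_group S Pi w -> w @` A = A.
Proof.
move=> PiA w /(_ [set f | f @` A = A]); apply; split; last by move=> _ [a /PiA aA <-].
split; first exact: image_id.
- by move=> f g /= fA gA; rewrite -image_comp gA.
- move=> f g /= fA fg gf; rewrite -[X in g @` X]fA image_comp (_ : g \o f = id) ?image_id //.
  by apply/funext => u /=; rewrite fg.
Qed.

Lemma reflection_image a (A : set (root_span E)) : Rx (weight a) ->
  A `<=` nonisotropic E ->
  (forall v, A v -> A (v - a *~ pairing (weight v) (weight a))) ->
  reflection S a @` (@in_hyp R E @` A) = @in_hyp R E @` A.
Proof.
move=> Ra AR Aa; apply/seteqP; split=> [_ [_ [v Av <-] <-]|_ [v Av <-]].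
  have rv := Rx_root (AR _ Av).
  by exists (v - a *~ pairing (weight v) (weight a)); [exact: Aa|rewrite reflection_in_hyp].
have rv := Rx_root (AR _ Av); have Aw := Aa _ Av; have rw := Rx_root (AR _ Aw).
exists (in_hyp (v - a *~ pairing (weight v) (weight a))); first by eexists; [exact: Aw|].
rewrite reflection_in_hyp //; congr in_hyp; apply: weight_inj.
by rewrite weight_reflection weight_reflection (root_reflectionK cs).
Qed.

(** The lift of [reach] to V contains [Pi] and is stable under the group, so it contains the orbit
    of [Pi]. *)
Lemma reach_of_reflectable Pi : Pi `<=` nonisotropic E -> reflectable_set S Pi ->
  forall alpha, Rx alpha -> reach (@weight R E @` Pi) alpha.
Proof.
move=> PiR refl alpha Ra; have [v va] := root_span_lift (Rx_root Ra).
pose A := [set u | reach (@weight R E @` Pi) (weight u)].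
have AR : A `<=` nonisotropic E.
  by move=> u; apply: (reach_Rx cs) => _ [a /PiR Ra' <-].
have WA := @weyl_group_image Pi (@in_hyp R E @` A).
have : (@in_hyp R E @` nonisotropic E) (in_hyp v) by exists v => //; rewrite /nonisotropic /= va.
rewrite -refl => -[w Ww [a Pa wa]].
have : (w @` (@in_hyp R E @` A)) (in_hyp v).
  by exists (in_hyp a) => //; exists a => //; apply: reach_base; exists a.
rewrite WA //; last first.
  move=> b Pb; apply: reflection_image => //; first exact: PiR.
  by move=> u Au; rewrite /A /= weight_reflection; apply: reach_step => //; exists b.
by move=> [u Au /in_hyp_inj uv]; rewrite -va -uv.
Qed.

Lemma reflectable_of_reach Pi : Pi `<=` nonisotropic E ->
  (forall alpha, Rx alpha -> reach (@weight R E @` Pi) alpha) -> reflectable_set S Pi.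
Proof.
move=> PiR reachP; apply/seteqP; split=> [_ [w Ww [a Pa <-]]|_ [v Rv <-]].
  rewrite -(@weyl_group_image Pi (@in_hyp R E @` nonisotropic E) _ w Ww).
    by exists (in_hyp a) => //; exists a => //; exact: PiR.
  move=> b Pb; apply: reflection_image => //; first exact: PiR.
  by move=> u Ru; rewrite /nonisotropic /= weight_reflection; apply: (root_reflection_Rx cs) => //; exact: PiR.
suff gen alpha : reach (@weight R E @` Pi) alpha -> forall u, weight u = alpha ->
    exists2 w, weyl_group S Pi w & exists2 a, Pi a & w (in_hyp a) = in_hyp u.
  by have [w Ww [a Pa wa]] := gen _ (reachP _ Rv) v erefl; exists w => //; exists a.
elim=> {alpha} [_ [a Pa <-] u /weight_inj ->|alpha beta ra IH [b Pb bE] v' v'E].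
  by exists id; [move=> G [[]]|exists a].
have Ra : Rx alpha by apply: (reach_Rx cs _ ra) => _ [c /PiR Rc <-].
have [u ua] := root_span_lift (Rx_root Ra).
have [w Ww [a Pa wa]] := IH u ua.
exists (reflection S b \o w).
  by move=> G GP; have [[_ Gcomp _] Grefl] := GP; apply: Gcomp; [apply: Grefl; exists b|exact: Ww].
exists a => //=; rewrite wa reflection_in_hyp; [|exact: PiR|by rewrite ua; exact: Rx_root].
by congr in_hyp; apply: weight_inj; rewrite weight_reflection v'E ua bE.
Qed.

(** [finite_reach] provides a finite reflectable set. One of least cardinality is a base, since a
    proper subset would have fewer elements; hence [refl] is a true minimum and not the default
    value. *)
Lemma minimal_reflectable : exists m,
  (exists2 Pi, reflectable_base S Pi & Pi #= `I_m) /\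
  forall Pi, reflectable_base S Pi -> `I_m #<= Pi.
Proof.
have [P [Pfin PR Preach]] := finite_reach cs.
pose good m := `[< exists Pi, [/\ Pi `<=` nonisotropic E, reflectable_set S Pi & Pi #= `I_m] >].
have exg : exists m, good m.
  have Pi_fin : finite_set (@weight R E @^-1` P).
    by apply: finite_preimage => // u v _ _; exact: weight_inj.
  have [m Pm] := (finite_setP _).1 Pi_fin; exists m; apply/asboolP.
  have PiR : @weight R E @^-1` P `<=` nonisotropic E by move=> v /PR.
  exists (@weight R E @^-1` P); split=> //; apply: reflectable_of_reach => // alpha /Preach.
  suff -> : @weight R E @` (@weight R E @^-1` P) = P by [].
  apply/seteqP; split=> [|b Pb]; first exact: image_preimage_subset.
  by have [v vb] := root_span_lift (Rx_root (PR _ Pb)); exists v; rewrite //= vb.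
case: (ex_minnP exg) => m /asboolP[Pi [PiR refl Pim]] min_m; exists m.
have min_le Pi' k : Pi' `<=` nonisotropic E -> reflectable_set S Pi' -> Pi' #= `I_k -> (m <= k)%N.
  by move=> *; apply: min_m; apply/asboolP; exists Pi'.
split.
  exists Pi => //; split=> // Pi' [sub nsub] refl'.
  have Pi'R : Pi' `<=` nonisotropic E by apply: subset_trans PiR.
  have Pi'fin : finite_set Pi'.
    by apply: sub_finite_set sub _; apply/finite_setP; exists m.
  have [k Pi'k] := (finite_setP _).1 Pi'fin.
  have mk := min_le _ _ Pi'R refl' Pi'k.
  apply: nsub => a Pa; apply: contrapT => nPa.
  (* Adding a missing element of [Pi] still gives a subset of [Pi], so k + 1 <= m. *)
  have : a |` Pi' #= `I_k.+1.
    by apply/eq_cardSP; exists a; [left|rewrite classical_sets.setUC setUDK // => _ [->]].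
  rewrite card_eq_le => /andP[_ le1].
  have : `I_k.+1 #<= `I_m.
    rewrite -(card_le_eqr Pim); apply: card_le_trans le1 _.
    by apply: subset_card_le => b [->//|/sub].
  by rewrite card_le_II ltnNge mk.
move=> Pi' [Pi'R refl' _].
case: (pselect (finite_set Pi')) => [/finite_setP[k Pi'k]|/infiniteP inf].
  by rewrite (card_le_eqr Pi'k) card_le_II; exact: min_le Pi'k.
by apply: card_le_trans inf; exact: subset_card_le.
Qed.

Lemma refl_attained : exists2 Pi, reflectable_base S Pi & Pi #= `I_(refl S).
Proof.
have [m [base_m min_m]] := minimal_reflectable.
by rewrite /refl; case: xgetP => [k _ [] //|/(_ m)[]].
Qed.

End ReflectableSets.

(** * The integral structure and the ranks of its isotropic lattices *)

Lemma range_of_card (M : zmodType) (A : set M) m : A #= `I_m ->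
  exists g : 'I_m -> M, range g = A.
Proof.
move=> Am; have Afin : finite_set A by apply/finite_setP; exists m.
pose s : seq M := finmap.enum_fset (fset_set A).
have size_s : size s = m := card_fset_set Am.
have memA a : (a \in s) = (a \in A) by exact: (in_fset_set Afin a).
exists (fun i => s`_i); apply/seteqP; split=> [_ [i _ <-]|a /mem_set].
  by apply: set_mem; rewrite -memA mem_nth // size_s.
rewrite -memA => as_; have lt_a : (index a s < m)%N by rewrite -size_s index_mem.
by exists (Ordinal lt_a) => //=; rewrite nth_index.
Qed.

Section IntegralStructure.
Context {R : realType} (E : eala R) (tau : E -> E) (x : dual_cartan E -> E).
Implicit Types (alpha beta sigma : dual_cartan E) (P : set (dual_cartan E)).
Hypothesis ci : chevalley_involution tau.
Hypothesis cs : chevalley_system tau x.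
Hypothesis no_double : forall alpha beta, Rx alpha -> Rx beta ->
  ~ isotropic_roots E (beta - alpha *~ 2).
Hypothesis transversal : forall alpha, Rx alpha -> exists gamma,
  [/\ Rx gamma, pairing alpha gamma != 0 &
      forall k l : int, zspan (isotropic_roots E) (gamma *~ k + alpha *~ l) -> k = 0].

Definition isotropic_lattice sigma := zspan (brk x sigma @` nonisotropic_roots E).

(** Induction on [reach]: by [brk_reflection], each step adds only an integral combination of
    brackets already obtained. *)
Lemma isotropic_lattice_reach sigma P : isotropic_roots E sigma ->
  P `<=` nonisotropic_roots E -> (forall alpha, Rx alpha -> reach P alpha) ->
  isotropic_lattice sigma = zspan (brk x sigma @` P).
Proof.
move=> s0 PR Preach; apply: zspan_eq; last by move=> _ [a Pa <-]; apply: zspan_gen; exists a => //; exact: PR.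
move=> _ [a /Preach ra <-]; elim: ra => {a} [a Pa|a b ra IH Pb].
  by apply: zspan_gen; exists a.
have [m [n ->]] := brk_reflection ci cs no_double transversal (reach_Rx cs PR ra) (PR _ Pb) s0.
by apply/zspanMz/zspanD => //; apply/zspanMz/zspan_gen; exists b.
Qed.

Lemma isotropic_lattice_finite sigma P m : isotropic_roots E sigma ->
  P `<=` nonisotropic_roots E -> (forall alpha, Rx alpha -> reach P alpha) ->
  (P #= `I_m)%card ->
  exists g : 'I_m -> E, isotropic_lattice sigma = zspan (range g).
Proof.
move=> s0 PR Preach Pm; rewrite (isotropic_lattice_reach s0 PR Preach).
have [g gP] := range_of_card Pm; exists (brk x sigma \o g).
by rewrite -gP image_comp.
Qed.

(** The rank is the least number of generators, which involves no splitting; minimal generators are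
    free because a complex vector space has no torsion. Each splitting then has a reflectable base
    of [refl S] elements whose brackets generate the lattice. *)
Lemma isotropic_lattice_free sigma : isotropic_roots E sigma ->
  exists2 r, free_abelian_of_rank (isotropic_lattice sigma) r &
    forall S : splitting E, (r <= refl S)%N.
Proof.
move=> s0; have [P [/finite_setP[m Pm] PR Preach]] := finite_reach cs.
have [g gE] := isotropic_lattice_finite s0 PR Preach Pm.
have [k [h [hg min_k]]] := minimal_generators g.
exists k.
  exists h; split; first by rewrite hg gE.
  have tf (v : E) (c : int) : c != 0 -> v *~ c = 0 -> v = 0.
    move=> c0 /eqP; rewrite -[v *~ c]scaler_int scaler_eq0 intr_eq0 (negPf c0) /=.
    by move/eqP.
  apply: (free_of_minimal_generators (A := zspan (range g)) tf); first by rewrite hg.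
  by move=> l f fg; apply: (min_k _ f); rewrite -fg.
move=> S; have [Pi [PiR refl_Pi _] Pim] := refl_attained S cs.
have wPim : @weight R E @` Pi #= `I_(refl S).
  by apply: card_eq_trans Pim; apply: inj_card_eq => u v _ _; exact: weight_inj.
have wPiR : @weight R E @` Pi `<=` nonisotropic_roots E by move=> _ [a /PiR Ra <-].
have [f fE] := isotropic_lattice_finite s0 wPiR (reach_of_reflectable cs PiR refl_Pi) wPim.
by apply: (min_k _ f); rewrite -fE -gE.
Qed.

Lemma isotropic_lattice_root_space sigma : isotropic_lattice sigma `<=` root_space sigma.
Proof.
apply: zspan_ind.
- exact: root_space0.
- exact: root_spaceD.
- exact: root_spaceN.
- by move=> _ [a _ <-]; exact: (brk_root_space cs).
Qed.

Lemma core_chev_ext alpha : core E (chev x alpha).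
Proof.
case: (pselect (Rx alpha)) => Ra; first by rewrite chevE //; exact: (core_chev cs).
by rewrite chev_out //; exact: core0.
Qed.

Lemma isotropic_lattice_core sigma : isotropic_lattice sigma `<=` core E.
Proof.
apply: zspan_ind.
- exact: core0.
- exact: coreD.
- exact: coreN.
- by move=> _ [a _ <-]; apply: core_lie; exact: core_chev_ext.
Qed.

Lemma tau_chev_ext alpha : tau (chev x alpha) = - chev x (- alpha).
Proof.
case: (pselect (Rx alpha)) => Ra.
  by rewrite (chevE _ Ra) (chevE _ (Rx_opp Ra)) (tau_chev cs).
rewrite !chev_out ?(tau0 ci) ?oppr0 // => /Rx_opp.
by rewrite opprK.
Qed.

(** [tau] maps the bracket of alpha at sigma to that of - alpha at - sigma, the two signs
    cancelling. *)
Lemma tau_isotropic_lattice sigma u :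
  isotropic_lattice sigma u -> isotropic_lattice (- sigma) (tau u).
Proof.
move=> Lu; have Cu := isotropic_lattice_core Lu; move: u Lu Cu.
(* Membership in the core is carried along the induction, since additivity of [tau] is given only
   there. *)
suff H u : isotropic_lattice sigma u -> core E u /\ isotropic_lattice (- sigma) (tau u).
  by move=> u /H[].
move: u; apply: zspan_ind.
- by split; [exact: core0|rewrite (tau0 ci); exact: zspan0].
- move=> u v [cu Lu] [cv Lv]; split; first exact: coreD.
  by rewrite (tauD ci) //; exact: zspanD.
- move=> u [cu Lu]; split; first exact: coreN.
  by rewrite (tauN ci) //; exact: zspanN.
- move=> _ [a Ra <-]; split; first by apply: core_lie; exact: core_chev_ext.
  rewrite (tau_lie ci); try exact: core_chev_ext.
  rewrite !tau_chev_ext lieNl [lie _ (- _)]linearN opprK; apply: zspan_gen.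
  by exists (- a); [exact: Rx_opp|rewrite /brk opprD].
Qed.

Lemma isotropic_lattice_tau sigma u : isotropic_lattice sigma u ->
  exists2 v, isotropic_lattice (- sigma) v & tau v = u.
Proof.
move: u; apply: zspan_ind.
- by exists 0; [exact: zspan0|exact: (tau0 ci)].
- move=> _ _ [u Lu <-] [v Lv <-]; exists (u + v); first exact: zspanD.
  by rewrite (tauD ci (isotropic_lattice_core Lu) (isotropic_lattice_core Lv)).
- move=> _ [u Lu <-]; exists (- u); first exact: zspanN.
  by rewrite (tauN ci (isotropic_lattice_core Lu)).
- move=> _ [a Ra <-]; exists (brk x (- sigma) (- a)).
    by apply: zspan_gen; exists (- a) => //; exact: Rx_opp.
  rewrite (tau_lie ci); try exact: core_chev_ext.
  by rewrite !tau_chev_ext lieNl [lie _ (- _)]linearN opprK /brk opprD !opprK.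
Qed.

Definition integral_basis : set E :=
  (x @` nonisotropic_roots E) `|`
  [set z | z != 0 /\ exists2 sigma, isotropic_roots E sigma & isotropic_lattice sigma z].

Lemma integral_basis_Rx alpha : Rx alpha ->
  integral_basis `&` root_space alpha = [set x alpha].
Proof.
move=> Ra; apply/seteqP; split=> [b [[[beta Rb <-]|[b0 [s s0 Ls]]] ab]|_ ->].
- by rewrite (root_space_inj (chev_root cs Rb) ab (chev_neq0 cs Rb)).
- case: (Rx_not_iso Ra).
  by rewrite (root_space_inj ab (isotropic_lattice_root_space Ls) b0).
- by split; [left; exists alpha|exact: (chev_root cs)].
Qed.

Lemma integral_basis_iso sigma : isotropic_roots E sigma ->
  integral_basis `&` root_space sigma = [set z | z != 0 /\ isotropic_lattice sigma z].
Proof.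
move=> s0; apply/seteqP; split=> [b [[[beta Rb <-]|[b0 [s _ Ls]]] ab]|b [b0 Lb]].
- case: (Rx_not_iso Rb).
  by rewrite (root_space_inj (chev_root cs Rb) ab (chev_neq0 cs Rb)).
- by split=> //; rewrite (root_space_inj ab (isotropic_lattice_root_space Ls) b0).
- split; last exact: isotropic_lattice_root_space.
  by right; split=> //; exists sigma.
Qed.

Lemma zspan_integral_basis sigma : isotropic_roots E sigma ->
  zspan (integral_basis `&` root_space sigma) = isotropic_lattice sigma.
Proof.
move=> s0; rewrite integral_basis_iso //; apply: zspan_eq => [z [_ Lz]//|z Lz].
case: (eqVneq z 0) => [->|z0]; first exact: zspan0.
by apply: zspan_gen; split=> //; exact: zspan_gen.
Qed.

(** If [alpha + sigma] is outside R^x, the bracket is zero on the left and absent on the right. *)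
Lemma chev_brackets sigma : isotropic_roots E sigma ->
  isotropic_lattice sigma = zspan (\bigcup_(alpha in nonisotropic_roots E)
    [set lie u v | u in integral_basis `&` root_space (alpha + sigma)
                 & v in integral_basis `&` root_space (- alpha)]).
Proof.
move=> s0; apply: zspan_eq => [_ [a Ra <-]|_ [a Ra [u Bu [v Bv <-]]]]; last first.
  rewrite integral_basis_Rx in Bv; last exact: Rx_opp.
  have u0 : u != 0 by case: Bu => [[[b Rb <-]|[]//] _]; exact: (chev_neq0 cs).
  have Ras : Rx (a + sigma).
    by apply: (Rx_shiftP cs) => //; case: Bu => _ ru; exists u.
  rewrite integral_basis_Rx // in Bu; rewrite Bu Bv; apply: zspan_gen.
  by exists a => //; rewrite /brk !chevE //; exact: Rx_opp.
case: (pselect (Rx (a + sigma))) => Ras; last first.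
  by rewrite /brk (chev_out _ Ras) lie0l; exact: zspan0.
apply: zspan_gen; exists a => //; exists (x (a + sigma)); first by rewrite integral_basis_Rx.
exists (x (- a)); first by rewrite integral_basis_Rx //; exact: Rx_opp.
by rewrite /brk !chevE //; exact: Rx_opp.
Qed.

Lemma tau_integral_basis : tau @` integral_basis = -%R @` integral_basis.
Proof.
have tau_neq0 z : core E z -> z != 0 -> tau z != 0.
  move=> cz; apply: contraNneq => tz; apply/eqP/(tau_inj ci) => //; first exact: core0.
  by rewrite tz (tau0 ci).
apply/seteqP; split=> [_ [y By <-]|_ [y By <-]].
  case: By => [[a Ra <-]|[y0 [s s0 Ls]]].
    exists (x (- a)); last by rewrite (tau_chev cs).
    by left; exists (- a) => //; exact: Rx_opp.
  exists (- tau y); last by rewrite opprK.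
  right; split; first by rewrite oppr_eq0 tau_neq0 //; exact: isotropic_lattice_core Ls.
  by exists (- s); [exact: iso_opp|exact/zspanN/tau_isotropic_lattice].
case: By => [[a Ra <-]|[y0 [s s0 Ls]]].
  have Rna := Rx_opp Ra; exists (x (- a)); first by left; exists (- a).
  by rewrite (tau_chev cs) // opprK.
have [u Lu uy] := isotropic_lattice_tau (zspanN Ls).
exists u => //; right; split; last by exists (- s) => //; exact: iso_opp.
apply: contraNneq y0 => u0; move/eqP: uy.
by rewrite u0 (tau0 ci) eq_sym oppr_eq0.
Qed.

Lemma integral_basis_structure : integral_structure tau integral_basis.
Proof.
split.
- move=> b [[a Ra <-]|[_ [s _ Ls]]]; first exact: (core_chev cs).
  exact: isotropic_lattice_core Ls.
- move=> b [[a Ra <-]|[b0 [s _ Ls]]].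
    by split; [exact: (chev_neq0 cs)|exists a; exact: (chev_root cs)].
  by split=> //; exists s; exact: isotropic_lattice_root_space.
- exact: tau_integral_basis.
- by exists x => // a Ra; exact: integral_basis_Rx.
- by move=> s s0; rewrite zspan_integral_basis // -chev_brackets.
Qed.

End IntegralStructure.

Theorem proposition3p2p3 (R : realType) (E : eala R) (n : nat)
    (tau : E -> E) (x : dual_cartan E -> E) :
  reduced_type E -> has_rank E n -> (1 < n)%N ->
  chevalley_involution tau -> chevalley_system tau x ->
  exists B : set E,
    [/\ x @` nonisotropic_roots E `<=` B,
        integral_structure tau B &
        forall sigma, isotropic_roots E sigma ->
          exists2 r, free_abelian_of_rank (zspan (B `&` root_space sigma)) r &
            forall S : splitting E, (r <= refl S)%N].
Proof.
move=> red rk n1 ci cs; have no2 := reduced_no_double cs red.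
have trans := exists_transversal cs rk n1.
exists (integral_basis x); split; first by move=> b Bb; left.
  exact: integral_basis_structure.
by move=> s s0; rewrite (zspan_integral_basis cs s0); exact: (isotropic_lattice_free ci cs no2 trans s0).
Qed.
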